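(* Let $\{y_t\}$ be generated by the ARMA model with parameter $\boldsymbol\eta_0$ and parameter set $\Pi$ described in the context. Assume the $\varepsilon_t$, $t\ge1$, are independent random variables with $\mathrm E(\varepsilon_t)=0$ and $\mathrm E(\varepsilon_t^2)=\sigma^2$ for all $t\ge1$. Assume that there exist positive constants $\alpha_1,\xi,M_1$ such that for any $0<s_2-s_1\le\xi$, $$\sup_{1\le m\le t<\infty,\ \|\mathbf v\|=1}|F_{t,m,\mathbf v}(s_2)-F_{t,m,\mathbf v}(s_1)|\le M_1(s_2-s_1)^{\alpha_1},$$ where $\mathbf v\in\mathbb R^m$ and $F_{t,m,\mathbf v}$ denotes the distribution function of $\mathbf v^{\mathrm T}(\varepsilon_t,\dots,\varepsilon_{t+1-m})^{\mathrm T}$. Assume further that for some $q_1>q\ge1$, $$\sup_{t\ge1}\mathrm E|\varepsilon_t|^{4q_1}<\infty.$$ Let $\hat{\boldsymbol\eta}_n=\arg\min_{\boldsymbol\eta\in\Pi}\sum_{t=1}^n(y_t-g_t(\boldsymbol\eta))^2$. Then $$\mathrm E\|n^{1/2}(\hat{\boldsymbol\eta}_n-\boldsymbol\eta_0)\|^q=O(1)\quad\text{as }n\to\infty.$$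
   Context: ARMA setting. Let $p_1,p_2\ge0$ be integers with $\bar p=p_1+p_2\ge1$. The observations satisfy $y_t=g_t(\boldsymbol\eta_0)+\varepsilon_t$, $t\ge1$, where $\boldsymbol\eta_0=(\alpha_{0,1},\dots,\alpha_{0,p_1},\beta_{0,1},\dots,\beta_{0,p_2})^{\mathrm T}$ is an unknown coefficient vector, $$g_t(\boldsymbol\eta_0)=\alpha_{0,1}y_{t-1}+\cdots+\alpha_{0,p_1}y_{t-p_1}-\beta_{0,1}\varepsilon_{t-1}-\cdots-\beta_{0,p_2}\varepsilon_{t-p_2},$$ with initial conditions $y_t=\varepsilon_t=0$ for all $t\le0$. For a general $\boldsymbol\eta=(\alpha_1,\dots,\alpha_{p_1},\beta_1,\dots,\beta_{p_2})^{\mathrm T}$, define $\varepsilon_t(\boldsymbol\eta)=0$ for $t\le0$ and recursively for $t\ge1$ $$\varepsilon_t(\boldsymbol\eta)=y_t-g_t(\boldsymbol\eta)=y_t-\alpha_1y_{t-1}-\cdots-\alpha_{p_1}y_{t-p_1}+\beta_1\varepsilon_{t-1}(\boldsymbol\eta)+\cdots+\beta_{p_2}\varepsilon_{t-p_2}(\boldsymbol\eta),$$ so that $\varepsilon_t(\boldsymbol\eta_0)=\varepsilon_t$; this also defines $g_t(\boldsymbol\eta)$. $\Pi\subset\mathbb R^{p_1+p_2}$ is a compact set that contains $\boldsymbol\eta_0$ as an interior point and all of whose elements $\boldsymbol\eta$ satisfy: with $A_{1,\boldsymbol\eta}(z)=1-\sum_{j=1}^{p_1}\alpha_jz^j$ and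 $A_{2,\boldsymbol\eta}(z)=1-\sum_{j=1}^{p_2}\beta_jz^j$, (1) $A_{1,\boldsymbol\eta}(z)\ne0$ and $A_{2,\boldsymbol\eta}(z)\neq0$ for all $|z|\le1$; (2) $A_{1,\boldsymbol\eta}$ and $A_{2,\boldsymbol\eta}$ have no common zeros; (3) $|\alpha_{p_1}|+|\beta_{p_2}|>0$ (a term with index $0$ is omitted). $\|\cdot\|$ is the Euclidean norm. *)

(* Defs.v *)
From mathcomp Require Import all_boot all_order all_algebra.
From mathcomp Require Import all_classical all_reals all_analysis.
From mathcomp Require Import measurable_realfun complex.

Set Implicit Arguments.
Unset Strict Implicit.
Unset Printing Implicit Defensive.

Import Order.TTheory GRing.Theory Num.Theory.
Import numFieldNormedType.Exports.

Local Open Scope classical_set_scope.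
Local Open Scope ring_scope.

Definition enorm (R : realType) (k : nat) (v : 'rV[R]_k) : R :=
  Num.sqrt (\sum_(i < k) v 0 i ^+ 2).

Definition is_argmin (R : realType) (T : Type) (A : set T) (S : T -> R)
    (x : T) : Prop :=
  A x /\ forall y, A y -> S x <= S y.

Definition independent_RVs (d : measure_display) (T : measurableType d)
    (R : realType) (P : probability T R) (I : eqType) (D : set I)
    (X : I -> {RV P >-> R}) : Prop :=
  forall (s : seq I) (B : I -> set R), uniq s -> [set` s] `<=` D ->
    (forall i, i \in s -> measurable (B i)) ->
    P (\bigcap_(i in [set` s]) (X i @^-1` B i)) =
    (\prod_(i <- s) P (X i @^-1` B i))%E.

(* The random variable v^T (eps_t, ..., eps_(t+1-m))^T; v is indexed from 0. *)
Definition noise_comb (d : measure_display) (T : measurableType d)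
    (R : realType) (P : probability T R) (eps : nat -> {RV P >-> R})
    (t m : nat) (v : 'rV[R]_m) : {RV P >-> R} :=
  \sum_(j < m) scale_mfun (v 0 j) (eps (t - j)%N).

Section arma.
Context (R : realType) (p1 p2 : nat).
Implicit Types (eta : 'rV[R]_(p1 + p2)) (y e : nat -> R).

(* With j : 'I_p1 (resp. 'I_p2) counted from 0, these are alpha_(j+1) and
   beta_(j+1). *)
Definition ar_coef eta (j : 'I_p1) : R := eta 0 (lshift p2 j).
Definition ma_coef eta (j : 'I_p2) : R := eta 0 (rshift p1 j).

Definition ar_poly eta : {poly R} :=
  1 - \sum_(j < p1) ar_coef eta j *: 'X^(j.+1).
Definition ma_poly eta : {poly R} :=
  1 - \sum_(j < p2) ma_coef eta j *: 'X^(j.+1).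

(* The filtered sums select the single index p1 - 1 (resp. p2 - 1), that is the
   coefficient alpha_p1 (resp. beta_p2), and are empty when p1 = 0 (resp.
   p2 = 0). *)
Definition arma_admissible eta : Prop :=
  let A1 := map_poly (real_complex R) (ar_poly eta) in
  let A2 := map_poly (real_complex R) (ma_poly eta) in
  [/\ forall z : R[i], `|z| <= 1 -> A1.[z] != 0 /\ A2.[z] != 0,
      forall z : R[i], ~ (root A1 z /\ root A2 z)
    & 0 < \sum_(j < p1 | j.+1 == p1) `|ar_coef eta j|
        + \sum_(j < p2 | j.+1 == p2) `|ma_coef eta j| ].

(* Sequences indexed by the time t >= 1 are functions on nat whose value at 0
   is 0: as t - j.+1 is a truncated subtraction, every time t <= 0 is read at
   index 0, which implements the zero initial conditions. *)
Definition arma_rhs eta y e (t : nat) : R :=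
  \sum_(j < p1) ar_coef eta j * y (t - j.+1)%N
  - \sum_(j < p2) ma_coef eta j * e (t - j.+1)%N.

Fixpoint resid_upto eta y (n : nat) : nat -> R :=
  if n is m.+1 then
    fun t => if t == m.+1 then y t - arma_rhs eta y (resid_upto eta y m) t
             else resid_upto eta y m t
  else fun=> 0.

(* epsilon_t(eta); its defining recursion is resid0 and residE below. *)
Definition resid eta y (t : nat) : R := resid_upto eta y t t.

(* g_t(eta) *)
Definition arma_g eta y (t : nat) : R := arma_rhs eta y (resid eta y) t.

Definition ls_objective y (n : nat) eta : R :=
  \sum_(1 <= t < n.+1) (y t - arma_g eta y t) ^+ 2.

Lemma resid0 eta y : resid eta y 0 = 0.
Proof. by []. Qed.

Lemma resid_uptoE eta y n t : (t <= n)%N -> resid_upto eta y n t = resid eta y t.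
Proof.
elim: n => [|n IHn]; first by rewrite leqn0 => /eqP ->.
rewrite leq_eqVlt => /predU1P[->//|tn]; rewrite /= ifN ?IHn//.
by rewrite neq_ltn tn.
Qed.

Lemma residE eta y t : (0 < t)%N -> resid eta y t = y t - arma_g eta y t.
Proof.
case: t => // t _; rewrite /resid /= eqxx /arma_g /arma_rhs.
congr (_ - (_ - _)); apply: eq_bigr => j _; rewrite resid_uptoE//.
by rewrite subSS leq_subr.
Qed.

Lemma resid_true eta y e : e 0%N = 0 ->
  (forall t, (0 < t)%N -> y t = arma_rhs eta y e t + e t) ->
  resid eta y =1 e.
Proof.
move=> e0 ye t; elim/ltn_ind: t => -[|t] IH; first by rewrite e0.
rewrite residE// ye// /arma_g.
suff -> : arma_rhs eta y (resid eta y) t.+1 = arma_rhs eta y e t.+1.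
  by rewrite addrC addKr.
congr (_ - _); apply: eq_bigr => j _.
by rewrite IH// subSS ltnS leq_subr.
Qed.

End arma.

(* Main.v *)
From HB Require Import structures.
Require Import Defs.
From mathcomp Require Import all_boot all_order all_algebra.
From mathcomp Require Import all_classical all_reals all_analysis.
From mathcomp Require Import measurable_realfun complex.
From mathcomp Require Import ring lra zify.

(** Write [A1], [A2] for the autoregressive and moving average polynomials of
    [eta], [A10], [A20] for those of [eta0], and [D_t] for the difference of the
    residual of [eta] and the noise at time [t].  In the ring of power series the
    ARMA recursions read [A10 y = A20 eps] and [A1 y = A2 (eps + D)], whence
    [F D = N eps] with [F = A10 A2] and [N = A1 A20 - A10 A2].  The numerator [N]
    is linear in [eta - eta0], and coprimality of [A10], [A20] together with the
    degree condition makes it an injective function of [eta - eta0]; so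
    [|eta - eta0|] is controlled by the vector [c] of the coefficients of [N]
    ([arma_numer_lower_bound]).

    The minimality of the least squares estimator gives the basic inequality
    [sum D_t^2 <= - 2 sum eps_t D_t], and both sides are compared with
    quantities that no longer depend on [eta].
    - On the left, [N eps = F D] and Young's inequality bound [sum (N eps)_t^2] by
      a constant times [sum D_t^2].  The former is a quadratic form in [c] whose
      matrix is the Gram matrix of the lagged noise; it exceeds
      [s2 n |c|^2 / 4], with [s2] the variance of the noise, unless some centred
      sample covariance of the noise is of order [n] ([gram_lower_bound]).
    - On the right, [D = N H eps] with [H = 1 / F].  As [F] has no zero in the
      closed unit disc and the parameter set is compact, the coefficients of [H]
      are bounded by [K rho^s] with [rho < 1], uniformly in the parameter
      ([arma_denom_inverse_decay]).  Hence [|sum eps_t D_t|] is at most [K |c| Q],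
      where [Q] is the sum of the sample covariances of lag [l > 0] of the noise,
      weighted by powers of [rho] ([cross_upper_bound]).
    Consequently [|eta - eta0| <= C Q / n] outside of the exceptional event, and
    [|eta - eta0| <= C] everywhere ([estimation_error_bound]).

    For the moments, choose an integer [k] with [q <= 2 k + 2 <= 2 q].  The
    sample covariances are sums of [n] martingale differences with bounded moments
    of order [2 k + 2], so that their moments of this order are [O(n^(k+1))]
    ([moment_sum_bound], [centred_cov_moment]).  This bounds [Q] directly; on the
    exceptional event the trivial bound on the error is multiplied by a power of
    the deviation of the Gram matrix divided by its threshold
    ([scaled_error_power_le]).  The regularity of the distribution functions only
    serves to ensure that the variance [s2] is positive ([second_moment_gt0]). *)

Set Implicit Arguments.
Unset Strict Implicit.
Unset Printing Implicit Defensive.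

Import Order.TTheory GRing.Theory Num.Theory.
Import numFieldNormedType.Exports.

Local Open Scope classical_set_scope.
Local Open Scope ring_scope.

(** * Independence *)

Section independence.
Context d (T : measurableType d) (R : realType) (P : probability T R).

Lemma indep_mean_mul_eq0 (U V : {RV P >-> R}) :
  (forall A B : set R, measurable A -> measurable B ->
    P ((U @^-1` A) `&` (V @^-1` B)) = (P (U @^-1` A) * P (V @^-1` B))%E) ->
  P.-integrable setT (fun w => (U w * V w)%:E) ->
  P.-integrable setT (fun w => (V w)%:E) ->
  (\int[P]_w (V w)%:E = 0)%E ->
  (\int[P]_w (U w * V w)%:E = 0)%E.
Proof.
move=> UV iUV iV V0.
pose W w := (U w, V w).
have mW : measurable_fun setT W by apply/measurable_fun_pairP; split.
pose f (z : R * R) : \bar R := (z.1 * z.2)%:E.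
have mf : measurable_fun setT f.
  apply/measurable_EFinP; apply: measurable_funM;
    [exact: measurable_fst|exact: measurable_snd].
pose WW : {mfun T >-> (R * R)%type} := HB.pack W (isMeasurableFun.Build _ _ _ _ W mW).
have lawW A : measurable A -> (distribution P U \x distribution P V)%E A = distribution P WW A.
  by move=> mA; apply: product_measure_unique => // B C mB mC; exact: UV.
have -> : (\int[P]_w (U w * V w)%:E = \int[distribution P WW]_z f z)%E.
  by rewrite integral_distribution.
rewrite (eq_measure_integral (distribution P U \x distribution P V)%E); last first.
  by move=> A mA _; exact: esym (lawW _ mA).
have if2 : ((distribution P U \x distribution P V)%E).-integrable setT f.
  apply/integrableP; split => //.
  rewrite (eq_measure_integral (distribution P WW)); last first.
    by move=> A mA _; exact: lawW.
  rewrite ge0_integral_distribution//; last first.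
    by apply: measurableT_comp.
  by case/integrableP : iUV.
rewrite -integral12_prod_meas1//=.
apply: integral0_eq => x _; rewrite /fubini_F/= /f /=.
under eq_integral do rewrite EFinM.
rewrite integralZl//; last first.
  by apply: integrable_pushforward.
rewrite (_ : (\int[_]_y y%:E)%E = 0%E) ?mule0//.
rewrite (integral_distribution (X := V) (f := EFin))//.
Qed.

End independence.

Section past.
Context d (T : measurableType d) (R : realType) (P : probability T R).
Variable eps : nat -> {RV P >-> R}.

(** Cylinder events on [eps 1, ..., eps m]. *)
Definition past_cylinder (m : nat) : set (set T) :=
  [set A | exists2 B : nat -> set R, (forall i, measurable (B i)) &
     A = \bigcap_(i in [set` iota 1 m]) (eps i @^-1` B i)].

(** Measurability with respect to the sigma-algebra of [eps 1, ..., eps m]. *)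
Definition past_measurable (m : nat) (U : T -> R) : Prop :=
  measurable_fun setT (U : g_sigma_algebraType (past_cylinder m) -> R).

Lemma past_cylinder_measurable m : past_cylinder m `<=` measurable.
Proof.
move=> _ [B mB ->]; apply: fin_bigcap_measurable => // i _.
by rewrite -[_ @^-1` _]setTI; apply: measurable_funPT.
Qed.

Lemma setI_closed_past_cylinder m : setI_closed (past_cylinder m).
Proof.
move=> _ _ [B mB ->] [C mC ->]; exists (fun i => B i `&` C i).
  by move=> i; exact: measurableI.
by rewrite -bigcapI; apply: eq_bigcapr => i _; rewrite preimage_setI.
Qed.

Lemma past_measurable_RV m (U : T -> R) : past_measurable m U ->
  measurable_fun setT U.
Proof.
move=> mU _ B mB; have /= h := mU measurableT B mB.
exact: (smallest_sub (@sigma_algebra_measurable _ T)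
  (@past_cylinder_measurable m)) _ h.
Qed.

Lemma past_measurable_eps m i : (1 <= i <= m)%N -> past_measurable m (eps i).
Proof.
move=> im _ B mB; rewrite setTI; apply: sub_sigma_algebra.
exists (fun j => if j == i then B else setT).
  by move=> j; case: ifP.
apply/seteqP; split=> [x Bx j|x /(_ i)] /=.
  by case: eqP => // ->.
rewrite eqxx; apply.
by rewrite mem_iota; lia.
Qed.

Lemma past_measurable_cst m c : past_measurable m (fun=> c).
Proof. exact: measurable_cst. Qed.

Lemma past_measurableD m U V : past_measurable m U -> past_measurable m V ->
  past_measurable m (fun w => U w + V w).
Proof. exact: measurable_funD. Qed.

Lemma past_measurableM m U V : past_measurable m U -> past_measurable m V ->
  past_measurable m (fun w => U w * V w).
Proof. exact: measurable_funM. Qed.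

Lemma past_measurableX m U k : past_measurable m U ->
  past_measurable m (fun w => U w ^+ k).
Proof. exact: measurable_funX. Qed.

Lemma past_measurable_sum m n (F : nat -> T -> R) :
  (forall t, (t < n)%N -> past_measurable m (F t)) ->
  past_measurable m (fun w => \sum_(t < n) F t w).
Proof.
elim: n => [_|n IH h].
  rewrite (_ : (fun _ => _) = fun=> 0); first exact: past_measurable_cst.
  by apply/funext => w; rewrite big_ord0.
rewrite (_ : (fun _ => _) = fun w => \sum_(t < n) F t w + F n w).
  by apply: past_measurableD; [apply: IH => t tn; apply: h; rewrite ltnW|exact: h].
by apply/funext => w; rewrite big_ord_recr.
Qed.

Hypothesis indep : independent_RVs [set t | (1 <= t)%N] eps.

(** Both sides are finite measures in the event [U @^-1` A], and they agree on the
    cylinders, which are stable under intersection and generate the past. *)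
Lemma past_indep m (U : T -> R) (A B : set R) : past_measurable m U ->
  measurable A -> measurable B ->
  P ((U @^-1` A) `&` (eps m.+1 @^-1` B)) =
  (P (U @^-1` A) * P (eps m.+1 @^-1` B))%E.
Proof.
move=> mU mA mB.
have mD : measurable (eps m.+1 @^-1` B).
  by rewrite -[_ @^-1` _]setTI; apply: measurable_funPT.
set D := _ @^-1` B in mD *.
have r0 : 0 <= fine (P D) by rewrite fine_ge0.
have gA : <<s past_cylinder m >> (U @^-1` A).
  by have := mU measurableT A mA; rewrite setTI.
have PD : (fine (P D))%:E = P D by rewrite fineK// fin_num_measure.
rewrite -PD muleC.
apply: (@g_sigma_algebra_measure_unique _ R T (past_cylinder m)
  (@past_cylinder_measurable m) (fun=> setT) _ _ (mrestr P mD)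
  (mscale (NngNum r0) P)) gA => //.
- move=> _; exists (fun=> setT) => //.
  by apply/seteqP; split => // x _ i _.
- by apply/seteqP; split => // x _; exists 0%N.
- exact: setI_closed_past_cylinder.
- move=> _ [C mC ->]; set X := \bigcap_(_ in _) _.
  suff XD : P (X `&` D) = (P X * P D)%E.
    by rewrite [RHS]muleC; apply: etrans XD _; rewrite -[in LHS]PD.
  have h1 : X `&` D =
     \bigcap_(i in [set` iota 1 m.+1]) (eps i @^-1` (if i == m.+1 then B else C i)).
    apply/seteqP; split=> x.
      move=> [xC xD] i; rewrite [X in X -> _]/mkset mem_iota => im.
      case: eqP => [->//|ne]; apply: xC; rewrite /mkset mem_iota; lia.
    move=> h; split.
      move=> i; rewrite [X in X -> _]/mkset mem_iota => im.
      have := h i; rewrite /mkset mem_iota ifN ?neq_ltn; last by lia.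
      apply; lia.
    by have := h m.+1; rewrite /mkset mem_iota eqxx; apply; lia.
  rewrite h1 indep//; first last.
  - by move=> i _; case: ifP.
  - by move=> i; rewrite [X in X -> _]/mkset mem_iota => /andP[].
  - exact: iota_uniq.
  rewrite (_ : iota 1 m.+1 = iota 1 m ++ [:: m.+1]); last first.
    by have := iotaD 1 m 1; rewrite addn1 add1n.
  rewrite big_cat big_seq1 eqxx; congr (_ * _)%E.
  rewrite indep//; last 2 first.
  - exact: iota_uniq.
  - by move=> i; rewrite [X in X -> _]/mkset mem_iota => /andP[].
  rewrite big_seq [RHS]big_seq; apply: eq_bigr => i.
  rewrite mem_iota => im; rewrite ifN// neq_ltn; lia.
- move=> _; apply: le_lt_trans (ltry 1%R).
  by apply: probability_le1; exact: measurableI.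
Qed.

(** The martingale difference property. *)
Lemma past_mean_mul_eq0 m (U V : T -> R) (phi : R -> R) :
  past_measurable m U -> measurable_fun setT phi ->
  V = phi \o eps m.+1 ->
  P.-integrable setT (fun w => (U w * V w)%:E) ->
  P.-integrable setT (fun w => (V w)%:E) ->
  (\int[P]_w (V w)%:E = 0)%E ->
  (\int[P]_w (U w * V w)%:E = 0)%E.
Proof.
move=> mU mphi VE.
have mV : measurable_fun setT V by rewrite VE; exact: measurableT_comp.
pose U' : {RV P >-> R} := HB.pack U
  (isMeasurableFun.Build _ _ _ _ U (past_measurable_RV mU)).
pose V' : {RV P >-> R} := HB.pack V (isMeasurableFun.Build _ _ _ _ V mV).
apply: (@indep_mean_mul_eq0 _ _ _ _ U' V') => A B mA mB /=.
rewrite VE; apply: (@past_indep m U A (phi @^-1` B)) => //.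
by rewrite -[_ @^-1` _]setTI; exact: mphi.
Qed.

End past.

(** * Moments of sums of martingale differences *)

Section power_inequalities.
Context (R : realType).
Implicit Types (a b : R).

Lemma taylor2_pow_bound (n : nat) : exists2 c : R, 0 <= c & forall a b,
  `|(a + b) ^+ n.+2 - a ^+ n.+2 - n.+2%:R * a ^+ n.+1 * b| <=
  c * (Num.max `|a| `|b| ^+ n * b ^+ 2).
Proof.
elim: n => [|n [c c0 IH]].
  exists 1 => // a b; rewrite expr0 !mul1r expr1 [X in `|X|](_ : _ = b ^+ 2).
    by rewrite ger0_norm ?sqr_ge0.
  ring.
exists (n.+2%:R + 2 * c) => [|a b]; first by rewrite addr_ge0// mulr_ge0.
set m := Num.max _ _.
have am : `|a| <= m by rewrite le_max lexx.
have bm : `|b| <= m by rewrite le_max lexx orbT.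
have m0 : 0 <= m by exact: le_trans am.
have -> : (a + b) ^+ n.+3 - a ^+ n.+3 - n.+3%:R * a ^+ n.+2 * b =
  n.+2%:R * a ^+ n.+1 * b ^+ 2 +
  (a + b) * ((a + b) ^+ n.+2 - a ^+ n.+2 - n.+2%:R * a ^+ n.+1 * b).
  by rewrite !exprS -[n.+3]add1n natrD; ring.
rewrite [leRHS]mulrDl; apply: le_trans (ler_normD _ _) _; apply: lerD.
  rewrite -mulrA normrM normr_nat ler_wpM2l// normrM normrX.
  rewrite [`|b ^+ 2|]ger0_norm ?sqr_ge0// ler_wpM2r ?sqr_ge0//.
  by rewrite lerXn2r ?nnegrE.
rewrite normrM; apply: le_trans
  (_ : (m + m) * (c * (m ^+ n * b ^+ 2)) <= _).
  apply: ler_pM => //.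
  by apply: le_trans (ler_normD _ _) _; apply: lerD.
rewrite (exprS m n) le_eqVlt; apply/orP; left; apply/eqP; ring.
Qed.

(** Second order expansion of an even power in which the mixed remainder
    [a ^+ (2 k) * b ^+ 2] has been split at the threshold [a ^+ 2 = N * b ^+ 2]. *)
Lemma pow_mean_step (k : nat) : exists2 c : R, 0 <= c & forall N a b, 0 < N ->
  (a + b) ^+ (2 * k.+1) <= (1 + c / N) * a ^+ (2 * k.+1)
    + (2 * k.+1)%:R * (a ^+ (2 * k).+1 * b)
    + c * (N ^+ k + 1) * b ^+ (2 * k.+1).
Proof.
have [c c0 H] := taylor2_pow_bound (2 * k).
exists c => // N a b N0; have := H a b; rewrite mulnS.
set m := Num.max _ _.
have K2 (x : R) : x ^+ (2 + 2 * k) = (x ^+ 2) ^+ k * x ^+ 2.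
  by rewrite addnC exprD exprM.
have hm : m ^+ (2 * k) * b ^+ 2 <= (a ^+ 2) ^+ k * b ^+ 2 + b ^+ (2 + 2 * k).
  rewrite K2 -mulrDl ler_wpM2r ?sqr_ge0// exprM /m.
  case: (leP `|a| `|b|) => _; rewrite real_normK ?num_real//.
    by rewrite lerDr exprn_ge0 ?sqr_ge0.
  by rewrite lerDl exprn_ge0 ?sqr_ge0.
have hN : (a ^+ 2) ^+ k * b ^+ 2 <= a ^+ (2 + 2 * k) / N + N ^+ k * b ^+ (2 + 2 * k).
  rewrite !K2; set x := a ^+ 2; set y := b ^+ 2.
  have x0 : 0 <= x by exact: sqr_ge0.
  have y0 : 0 <= y by exact: sqr_ge0.
  have nN : 0 <= N by exact: ltW.
  have [yx|/ltW xy] := leP (N * y) x.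
    apply: (@le_trans _ _ (x ^+ k * x / N)).
      rewrite -(mulrA (x ^+ k)); apply: ler_wpM2l; first exact: exprn_ge0.
      by rewrite ler_pdivlMr 1?mulrC.
    by rewrite lerDl; do ![exact: nN|exact: y0|apply: mulr_ge0|apply: exprn_ge0].
  apply: (@le_trans _ _ (N ^+ k * (y ^+ k * y))).
    rewrite (mulrA (N ^+ k)) -exprMn; apply: ler_wpM2r => //; apply: lerXn2r => //.
    by rewrite nnegrE mulr_ge0.
  by rewrite lerDr; apply: divr_ge0 => //; apply: mulr_ge0 => //; exact: exprn_ge0.
move=> h.
have {}h := le_trans (ler_norm _) h.
have {}h := le_trans h (ler_wpM2l c0 hm).
have {}hN := ler_wpM2l c0 hN.
rewrite add2n.
rewrite add2n mulrDr in h hN *.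
rewrite -subr_ge0 in h; rewrite -subr_ge0 in hN; rewrite -subr_ge0.
apply: le_trans (addr_ge0 h hN) _; rewrite le_eqVlt; apply/orP; left; apply/eqP.
ring.
Qed.

Lemma geometric_recursion_bound (e : nat -> R) (r g : R) : 1 <= r -> 0 <= g ->
  e 0%N <= 0 -> (forall m, e m.+1 <= r * e m + g) ->
  forall m, e m <= m%:R * r ^+ m * g.
Proof.
move=> r1 g0 e0 he; elim=> [|m IH]; first by rewrite !mul0r.
have r0 : 0 <= r by exact: le_trans r1.
apply: le_trans (he m) _.
apply: le_trans (lerD (ler_wpM2l r0 IH) (lexx g)) _.
rewrite -[m.+1]addn1 natrD !mulrDl mul1r addn1 exprS; apply: lerD.
  by rewrite le_eqVlt; apply/orP; left; apply/eqP; ring.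
by rewrite ler_peMl// -exprS exprn_ege1.
Qed.

End power_inequalities.

Section moments.
Context d (T : measurableType d) (R : realType) (P : probability T R).
Implicit Types f g : T -> R.

Lemma integrable_dominated f g : measurable_fun setT f ->
  (forall w, `|f w| <= g w) ->
  P.-integrable setT (EFin \o g) -> P.-integrable setT (EFin \o f).
Proof.
move=> mf fg; apply: le_integrable => //; first exact/measurable_EFinP.
by move=> w _ /=; rewrite lee_fin (le_trans (fg w))// ler_norm.
Qed.

Lemma integrable_cst_fin (c : R) : P.-integrable setT (EFin \o (fun=> c)).
Proof. exact: finite_measure_integrable_cst. Qed.

Lemma Rintegral_cst_prob (c : R) : \int[P]_w c = c.
Proof.
by rewrite /Rintegral integral_cst//= probability_setT mule1.
Qed.

Lemma integrable_linear f g (a b : R) :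
  P.-integrable setT (EFin \o f) -> P.-integrable setT (EFin \o g) ->
  P.-integrable setT (EFin \o (fun w => a * f w + b * g w)).
Proof.
move=> hf hg.
rewrite (_ : _ \o _ = (fun w => (a%:E * (EFin \o f) w))
                       \+ (fun w => (b%:E * (EFin \o g) w)))%E; last first.
  by apply/funext => w /=; rewrite EFinD !EFinM.
by apply: integrableD => //; apply: integrableZl.
Qed.

Lemma Rintegral_linear f g (a b : R) :
  P.-integrable setT (EFin \o f) -> P.-integrable setT (EFin \o g) ->
  \int[P]_w (a * f w + b * g w) = a * \int[P]_w f w + b * \int[P]_w g w.
Proof.
move=> hf hg; rewrite RintegralD//; last 2 first.
- exact: (integrableZl measurableT a hf).
- exact: (integrableZl measurableT b hg).
by rewrite !RintegralZl.
Qed.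

Lemma normrM_exprS_le (n : nat) (a b : R) :
  `|a| ^+ n * `|b| <= `|a| ^+ n.+1 + `|b| ^+ n.+1.
Proof.
have [ab|/ltW ba] := leP `|a| `|b|.
  apply: (@le_trans _ _ (`|b| ^+ n.+1)); last by rewrite lerDr exprn_ge0.
  by rewrite exprSr ler_wpM2r// lerXn2r ?nnegrE.
apply: (@le_trans _ _ (`|a| ^+ n.+1)); last by rewrite lerDl exprn_ge0.
by rewrite exprSr ler_wpM2l// exprn_ge0.
Qed.

Lemma expr_even_norm (k : nat) (a : R) : `|a| ^+ (2 * k) = a ^+ (2 * k).
Proof. by rewrite !exprM real_normK// num_real. Qed.

Lemma expr_even_ge0 (k : nat) (a : R) : 0 <= a ^+ (2 * k).
Proof. by rewrite exprM exprn_ge0// sqr_ge0. Qed.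

Lemma expr_evenD_le (k : nat) (a b : R) :
  (a + b) ^+ (2 * k) <= 2 ^+ (2 * k) * (a ^+ (2 * k) + b ^+ (2 * k)).
Proof.
wlog ab : a b / `|a| <= `|b|.
  move=> h; have [/h//|/ltW/h] := leP `|a| `|b|.
  by rewrite addrC [b ^+ _ + _]addrC.
apply: (@le_trans _ _ ((2 * `|b|) ^+ (2 * k))).
  rewrite -expr_even_norm lerXn2r ?nnegrE ?mulr_ge0//.
  by rewrite (le_trans (ler_normD _ _))// mulr_natl mulr2n lerD2r.
rewrite exprMn expr_even_norm ler_wpM2l ?exprn_ge0//.
by rewrite lerDr expr_even_ge0.
Qed.

(** Burkholder-type bound with even exponent [2 k + 2]: [pow_mean_step] with
    [N := n] makes the moment grow by a factor [1 + c / n] at each of the [n]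
    steps, up to a remainder of order [n ^ k]. *)
Lemma moment_sum_bound (k : nat) : exists2 C : R, 0 <= C &
  forall (X : nat -> T -> R) (B : R),
  (forall t, measurable_fun setT (X t)) ->
  (forall t, P.-integrable setT (EFin \o (fun w => X t w ^+ (2 * k.+1)))) ->
  (forall t, \int[P]_w (X t w ^+ (2 * k.+1)) <= B) ->
  (forall n, P.-integrable setT
      (EFin \o (fun w => (\sum_(t < n) X t w) ^+ (2 * k).+1 * X n w)) ->
     \int[P]_w ((\sum_(t < n) X t w) ^+ (2 * k).+1 * X n w) = 0) ->
  forall n,
   P.-integrable setT (EFin \o (fun w => (\sum_(t < n) X t w) ^+ (2 * k.+1))) /\
   \int[P]_w ((\sum_(t < n) X t w) ^+ (2 * k.+1)) <= C * B * n%:R ^+ k.+1.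
Proof.
have [c c0 hc] := @pow_mean_step R k.
exists (2 * c * expR c); first by rewrite !mulr_ge0// expR_ge0.
move=> X B mX iX XB orth.
have B0 : 0 <= B.
  by apply: le_trans (XB 0%N); apply: Rintegral_ge0 => w _; exact: expr_even_ge0.
pose S n w := \sum_(t < n) X t w.
have SS n w : S n.+1 w = S n w + X n w by rewrite /S big_ord_recr.
have mS n : measurable_fun setT (S n).
  by apply: measurable_sum => i; exact: mX.
have iS n : P.-integrable setT (EFin \o (fun w => S n w ^+ (2 * k.+1))).
  elim: n => [|n IH].
    rewrite (_ : (fun w => _) = fun=> 0); first exact: integrable_cst_fin.
    by apply/funext => w; rewrite /S big_ord0 expr0n.
  apply: integrable_dominated (integrable_linear (2 ^+ (2 * k.+1))
    (2 ^+ (2 * k.+1)) IH (iX n)).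
    by apply: measurable_funX.
  by move=> w; rewrite ger0_norm ?expr_even_ge0// SS -mulrDr expr_evenD_le.
have iSX n : P.-integrable setT (EFin \o (fun w => S n w ^+ (2 * k).+1 * X n w)).
  apply: integrable_dominated (integrable_linear 1 1 (iS n) (iX n)).
    by apply: measurable_funM => //; exact: measurable_funX.
  move=> w; rewrite !mul1r normrM normrX.
  have := normrM_exprS_le (2 * k).+1 (S n w) (X n w).
  have K2 : ((2 * k).+2 = 2 * k.+1)%N by rewrite mulnS.
  by rewrite K2 !expr_even_norm.
move=> n; split; first exact: iS.
have [->|n0] := eqVneq n 0%N.
  rewrite [leRHS](_ : _ = 0); last by rewrite expr0n mulr0.
  rewrite (_ : (fun _ => _) = fun=> 0).
    by rewrite Rintegral_cst// mul0r.
  by apply/funext => w; rewrite big_ord0 expr0n.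
have N0 : 0 < n%:R :> R by rewrite ltr0n lt0n.
pose e m := \int[P]_w (S m w ^+ (2 * k.+1)).
pose r := 1 + c / n%:R; pose g := c * (n%:R ^+ k + 1) * B.
have r1 : 1 <= r by rewrite lerDl divr_ge0// ltW.
have g0 : 0 <= g by rewrite !mulr_ge0// addr_ge0// exprn_ge0// ltW.
have he m : e m.+1 <= r * e m + g.
  have h := integrable_linear 1 (2 * k.+1)%:R
     (integrable_linear r (c * (n%:R ^+ k + 1)) (iS m) (iX m)) (iSX m).
  apply: (@le_trans _ _ (\int[P]_w (1 * (r * S m w ^+ (2 * k.+1) +
     c * (n%:R ^+ k + 1) * X m w ^+ (2 * k.+1)) +
     (2 * k.+1)%:R * (S m w ^+ (2 * k).+1 * X m w)))).
    apply: le_Rintegral => // w _.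
    by rewrite SS; apply: le_trans (hc _ _ _ N0) _; rewrite mul1r addrAC.
  rewrite !Rintegral_linear//; last exact: integrable_linear.
  rewrite orth; last exact: iSX.
  rewrite mulr0 addr0 mul1r lerD2l ler_wpM2l//.
  by rewrite mulr_ge0// addr_ge0// exprn_ge0// ltW.
have e0 : e 0%N <= 0.
  rewrite /e (_ : (fun _ => _) = fun=> 0).
    by rewrite Rintegral_cst// mul0r.
  by apply/funext => w; rewrite /S big_ord0 expr0n.
apply: le_trans (geometric_recursion_bound r1 g0 e0 he n) _.
have rn : r ^+ n <= expR c.
  rewrite (_ : c = n%:R * (c / n%:R)); last by rewrite mulrCA divff ?mulr1// gt_eqF.
  by rewrite expRM_natl lerXn2r ?nnegrE ?expR_ge0 ?expR_ge1Dx// (le_trans _ r1).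
have nk : n%:R ^+ k + 1 <= 2 * n%:R ^+ k :> R.
  by rewrite mulr_natl mulr2n lerD2l exprn_ege1// ler1n lt0n.
apply: (@le_trans _ _ (n%:R * expR c * (c * (2 * n%:R ^+ k) * B))).
  apply: ler_pM => //.
  - by rewrite mulr_ge0// exprn_ge0// (le_trans _ r1).
  - by rewrite ler_wpM2l.
  - by rewrite ler_wpM2r// ler_wpM2l.
rewrite (exprS _ k) le_eqVlt; apply/orP; left; apply/eqP; ring.
Qed.

End moments.

(** * Sample covariances of the noise *)

(** The summand at time [t.+1] of the centred sample covariance of [e] at the
    lags [i] and [j].  On the diagonal the centring [s2] is only subtracted at
    the times [t.+1 > i], at which [e (t.+1 - i)] is not one of the vanishing
    initial values. *)
Definition centred_prod (R : realType) (s2 : R) (e : nat -> R) (i j t : nat) : R :=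
  if i == j then (if (i <= t)%N then e (t.+1 - i)%N ^+ 2 - s2 else 0)
  else e (t.+1 - i)%N * e (t.+1 - j)%N.

Section noise_moments.
Context d (T : measurableType d) (R : realType) (P : probability T R).
Variables (eps : nat -> {RV P >-> R}) (s2 B : R) (k : nat).
Hypothesis eps0 : forall w, eps 0%N w = 0.
Hypothesis indep : independent_RVs [set t | (1 <= t)%N] eps.
Hypothesis mean0 : forall t, (1 <= t)%N -> (\int[P]_w (eps t w)%:E = 0)%E.
Hypothesis var : forall t, (1 <= t)%N -> (\int[P]_w (eps t w ^+ 2)%:E = s2%:E)%E.
Hypothesis mom : forall t, (1 <= t)%N ->
  P.-integrable setT (EFin \o (fun w => eps t w ^+ (2 * (2 * k.+1)))) /\
  \int[P]_w (eps t w ^+ (2 * (2 * k.+1))) <= B.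

Let B_ge0 : 0 <= B.
Proof.
have [_] := mom (leqnn 1); apply: le_trans.
by apply: Rintegral_ge0 => w _; exact: expr_even_ge0.
Qed.

Let mom_all t :
  P.-integrable setT (EFin \o (fun w => eps t w ^+ (2 * (2 * k.+1)))) /\
  \int[P]_w (eps t w ^+ (2 * (2 * k.+1))) <= B.
Proof.
case: t => [|t]; last exact: mom.
rewrite (_ : (fun w => _) = fun=> 0); last first.
  by apply/funext => w; rewrite eps0 expr0n.
split; first exact: integrable_cst_fin.
by rewrite Rintegral_cst// mul0r.
Qed.

Let measurable_eps t : measurable_fun setT (eps t).
Proof. exact: measurable_funPT. Qed.

Let past_eps m i : (i <= m)%N -> past_measurable eps m (eps i).
Proof.
case: i => [_|i im]; last exact: past_measurable_eps.
rewrite (_ : (eps 0%N : T -> R) = fun=> 0); first exact: past_measurable_cst.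
by apply/funext.
Qed.

Let X i j t w := centred_prod s2 (eps ^~ w) i j t.

Let past_X i j t m : (i <= j)%N -> (t.+1 - i <= m)%N -> past_measurable eps m (X i j t).
Proof.
move=> ij tm; rewrite /X /centred_prod; case: eqP => _.
  case: (i <= t)%N; last exact: past_measurable_cst.
  apply: past_measurableD; last exact: past_measurable_cst.
  by apply: past_measurableX; exact: past_eps.
by apply: past_measurableM; apply: past_eps => //; apply: leq_trans tm; rewrite leq_sub2l.
Qed.

Let XK_le i j t w : `|X i j t w ^+ (2 * k.+1)| <=
  2 ^+ (2 * k.+1) * (1 * eps (t.+1 - i)%N w ^+ (2 * (2 * k.+1))
     + 1 * eps (t.+1 - j)%N w ^+ (2 * (2 * k.+1))) + 2 ^+ (2 * k.+1) * s2 ^+ (2 * k.+1).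
Proof.
rewrite ger0_norm ?expr_even_ge0// !mul1r -!mulrDr /X /centred_prod.
have [_|_] := eqVneq i j.
  case: ifP => _; last first.
    by rewrite expr0n mulr_ge0 ?exprn_ge0// !addr_ge0 ?expr_even_ge0.
  apply: le_trans (expr_evenD_le _ _ _) _; rewrite -[s2 ^+ _]expr_even_norm -normrN.
  rewrite expr_even_norm ler_wpM2l ?exprn_ge0// lerD2r.
  by rewrite -exprM lerDl expr_even_ge0.
apply: (@le_trans _ _ (eps (t.+1 - i)%N w ^+ (2 * (2 * k.+1)) +
                       eps (t.+1 - j)%N w ^+ (2 * (2 * k.+1)))).
  rewrite /= exprMn [(2 * (2 * k.+1))%N]mulnC !(exprM _ (2 * k.+1)%N 2) -subr_ge0.
  set a := eps _ _ ^+ _; set b := eps _ _ ^+ _.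
  rewrite (_ : _ - _ = ((a - b) ^+ 2 + (a ^+ 2 + b ^+ 2)) / 2); last by field.
  by rewrite divr_ge0// !addr_ge0// sqr_ge0.
set z := _ + _.
have z0 : 0 <= z by rewrite addr_ge0 ?expr_even_ge0.
apply: (@le_trans _ _ (z + s2 ^+ (2 * k.+1))); first by rewrite lerDl expr_even_ge0.
by rewrite ler_peMl ?exprn_ege1 ?ler1n// addr_ge0 ?expr_even_ge0.
Qed.

Let measurable_X i j t : measurable_fun setT (X i j t).
Proof.
rewrite /X /centred_prod; case: eqP => _; last exact: measurable_funM.
by case: (i <= t)%N => //; apply: measurable_funD => //; exact: measurable_funX.
Qed.

Let integrable_low (t n : nat) : (n <= 2 * (2 * k.+1))%N ->
  P.-integrable setT (EFin \o (fun w => eps t w ^+ n)).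
Proof.
move=> nk; apply: integrable_dominated (integrable_linear 1 1 (mom_all t).1
   (integrable_cst_fin P 1)).
  exact: measurable_funX.
move=> w; rewrite !mul1r -expr_even_norm normrX.
have [e1|/ltW e1] := leP `|eps t w| 1.
  by rewrite (le_trans (exprn_ile1 _ (normr_ge0 _) e1))// lerDr exprn_ge0.
by rewrite (le_trans (ler_weXn2l e1 nk))// lerDl.
Qed.

(** For [i <= j] the summand at time [t.+1] is a function of [eps (t.+1 - i)] with
    mean zero times a function of earlier noise, hence the partial sums form a
    martingale for the noise shifted by the lag [i]. *)
Lemma centred_cov_moment : exists2 C : R, 0 <= C & forall i j n, (i <= j)%N ->
  P.-integrable setT (EFin \o (fun w =>
    (\sum_(t < n) centred_prod s2 (eps ^~ w) i j t) ^+ (2 * k.+1))) /\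
  \int[P]_w ((\sum_(t < n) centred_prod s2 (eps ^~ w) i j t) ^+ (2 * k.+1))
    <= C * n%:R ^+ k.+1.
Proof.
have [C C0 H] := @moment_sum_bound _ T R P k.
pose c2 : R := 2 ^+ (2 * k.+1).
have c20 : 0 <= c2 by exact: exprn_ge0.
pose B' := c2 * (B + B) + c2 * s2 ^+ (2 * k.+1).
exists (C * B').
  rewrite mulr_ge0// addr_ge0// mulr_ge0// ?addr_ge0//; exact: expr_even_ge0.
move=> i j n ij.
have dom t := integrable_linear c2 (c2 * s2 ^+ (2 * k.+1)) (integrable_linear 1 1
   (mom_all (t.+1 - i)).1 (mom_all (t.+1 - j)).1) (integrable_cst_fin P 1).
have iX t : P.-integrable setT (EFin \o (fun w => X i j t w ^+ (2 * k.+1))).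
  apply: integrable_dominated (dom t); first exact: measurable_funX.
  by move=> w; rewrite mulr1; exact: XK_le.
apply: (H (X i j) B') => //.
- move=> t; apply: (@le_trans _ _ (\int[P]_w (c2 * (1 * eps (t.+1 - i)%N w ^+ (2 * (2 * k.+1))
     + 1 * eps (t.+1 - j)%N w ^+ (2 * (2 * k.+1))) + c2 * s2 ^+ (2 * k.+1) * 1))).
    apply: le_Rintegral => // w _; rewrite mulr1.
    exact: le_trans (ler_norm _) (XK_le _ _ _ _).
  rewrite Rintegral_linear//; last 2 first.
  - by apply: integrable_linear; exact: (mom_all _).1.
  - exact: integrable_cst_fin.
  rewrite Rintegral_linear; [|exact: (mom_all _).1|exact: (mom_all _).1].
  rewrite Rintegral_cst_prob !mul1r mulr1 lerD2r ler_wpM2l//.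
  by apply: lerD; exact: (mom_all _).2.
- move=> {}n iSX.
  have [ni|ni] := ltnP n i.
    (* up to time [i] the factor [eps (n.+1 - i)] is the zero initial value *)
    rewrite (_ : (fun w => _) = fun=> 0); first by rewrite Rintegral_cst// mul0r.
    apply/funext => w; rewrite {2}/X /centred_prod [(i <= n)%N]leqNgt ni/=.
    case: eqP => _; first by rewrite mulr0.
    by rewrite (_ : (n.+1 - i)%N = 0%N) ?eps0 ?mul0r ?mulr0//; lia.
  have pS : past_measurable eps (n - i) (fun w => (\sum_(t < n) X i j t w) ^+ (2 * k).+1).
    apply: past_measurableX; apply: past_measurable_sum => t tn; apply: past_X => //; lia.
  have le2 : (2 <= 2 * (2 * k.+1))%N by lia.
  have le1 : (1 <= 2 * (2 * k.+1))%N by lia.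
  have nE : (n.+1 - i)%N = (n - i).+1 by rewrite subSn.
  rewrite /Rintegral; have [ijE|ijN] := eqVneq i j.
    have XE w : X i j n w = eps (n - i).+1 w ^+ 2 - s2.
      by rewrite /X /centred_prod ijE eqxx -ijE ni nE.
    have iV : P.-integrable setT (EFin \o (fun w => X i j n w)).
      have := integrable_linear 1 (- s2) (integrable_low (n - i).+1 le2)
        (integrable_cst_fin P 1).
      by apply: eq_integrable => // w _ /=; rewrite XE mul1r mulr1.
    rewrite (@past_mean_mul_eq0 _ _ _ _ _ indep _ _ (X i j n) (fun x => x ^+ 2 - s2) pS) => //.
    + by apply: measurable_funD => //; exact: measurable_funX.
    + by apply/funext => w; rewrite XE.
    under eq_integral do rewrite XE EFinB.
    rewrite integralB//; last 2 first.
    * exact: (integrable_low (n - i).+1 le2).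
    * exact: (integrable_cst_fin P s2).
    by rewrite var// integral_cst//= probability_setT mule1 subee.
  have XE w : X i j n w = eps (n - i).+1 w * eps (n.+1 - j)%N w.
    by rewrite /X /centred_prod (negbTE ijN) nE.
  rewrite (eq_integral (fun w => ((\sum_(t < n) X i j t w) ^+ (2 * k).+1
    * eps (n.+1 - j)%N w * eps (n - i).+1 w)%:E)); last first.
    by move=> w _; rewrite XE [_ * eps (n.+1 - j)%N w]mulrC mulrA.
  rewrite (@past_mean_mul_eq0 _ _ _ _ _ indep (n - i) _ _ id _ _ _) => //.
  + by apply: past_measurableM => //; apply: past_eps; lia.
  + move: iSX; apply: eq_integrable => // w _ /=.
    by rewrite XE [_ * eps (n.+1 - j)%N w]mulrC mulrA.
  + exact: (integrable_low (n - i).+1 le1).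
  + exact: mean0.
Qed.

End noise_moments.

(** * Positivity of the variance *)

(** A random variable with zero second moment has a distribution function with a
    unit jump at [0], which contradicts Hoelder continuity. *)
Lemma second_moment_gt0 d (T : measurableType d) (R : realType)
    (P : probability T R) (X : {RV P >-> R}) (a x M s2 : R) :
  0 < a -> 0 < x -> 0 < M -> 0 <= s2 ->
  (forall u v : R, 0 < v - u -> v - u <= x ->
     (`|cdf X v - cdf X u| <= (M * (v - u) `^ a)%:E)%E) ->
  (\int[P]_w (X w ^+ 2)%:E = s2%:E)%E -> 0 < s2.
Proof.
move=> a0 x0 M0 s20 hcdf hX; rewrite lt_def s20 andbT; apply/eqP => s2E.
have mX : measurable_fun setT X by exact: measurable_funPT.
have tail (s : R) : 0 < s -> P [set w | s%:E <= `|(X w)%:E|]%E = 0%E.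
  move=> sp; have := @markov _ _ _ P X (fun r => r ^+ 2) s sp.
  have h1 : measurable_fun setT (fun r : R => r ^+ 2) by exact: measurable_funX.
  have h2 (r : R) : 0 <= r -> 0 <= r ^+ 2 by rewrite sqr_ge0.
  have h3 : {in Num.nneg &, {homo (fun r : R => r ^+ 2) : x y / x <= y}}.
    by move=> u v; rewrite !nnegrE => u0 v0 uv; exact: lerXn2r.
  move/(_ h1 h2 h3); rewrite unlock.
  rewrite (_ : \int[P]_w _ = 0)%E; last first.
    transitivity (\int[P]_w (X w ^+ 2)%:E)%E; last by rewrite hX s2E.
    apply: eq_integral => w _ /=; by rewrite real_normK// num_real.
  move=> h; apply/eqP; rewrite eq_le measure_ge0 andbT.
  by move: h; rewrite pmule_rle0// lte_fin exprn_gt0.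
have big (s : R) : 0 < s -> 2 * s <= x -> 1 <= M * (2 * s) `^ a.
  move=> sp sx; have sp2 : 0 < 2 * s by rewrite mulr_gt0.
  have := hcdf (- s) s; rewrite (_ : s - - s = 2 * s); last by ring.
  move=> /(_ sp2 sx).
  have mset (A : set R) : measurable A -> measurable (X @^-1` A).
    by move=> mA; rewrite -[_ @^-1` _]setTI; exact: mX.
  have mtail : measurable [set w | s%:E <= `|(X w)%:E|]%E.
    have -> : [set w | s%:E <= `|(X w)%:E|]%E = X @^-1` (Num.norm @^-1` `[s, +oo[%classic).
      by apply/seteqP; split=> w /=; rewrite in_itv/= andbT lee_fin.
    apply: mset; rewrite -[_ @^-1` _]setTI; exact: normr_measurable.
  have c1 : P (X @^-1` `]-oo, (- s)]) = 0%E.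
    apply/eqP; rewrite eq_le measure_ge0 andbT -[leRHS](tail s sp).
    apply: le_measure; rewrite ?inE//; first exact: mset.
    move=> w /=; rewrite in_itv/= lee_fin => h.
    by rewrite ler_normr; apply/orP; right; rewrite lerNr.
  have c2 : P (X @^-1` `]-oo, s]) = 1%E.
    apply/eqP; rewrite eq_le probability_le1/=; last exact: mset.
    rewrite -[leRHS]adde0 -[in leRHS](tail s sp) -(probability_setT P).
    apply: le_trans (measureU2 _ _ _) => //; last exact: mset.
    apply: le_measure; rewrite ?inE//.
      by apply: measurableU => //; exact: mset.
    move=> w _ /=; rewrite in_itv/= lee_fin.
    have [xs|/ltW sx'] := leP (X w) s; [by left|right].
    by rewrite (le_trans sx')// ler_norm.
  rewrite /cdf /distribution /pushforward.
  by rewrite c1 c2 sube0 abse1 lee_fin.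
(* [u] solves [M * u `^ a = 1 / 2] *)
pose u := ((2 * M)^-1) `^ a^-1.
have u0 : 0 < u by rewrite powR_gt0// invr_gt0 mulr_gt0.
pose s := Num.min x u / 2.
have sp : 0 < s by rewrite divr_gt0// lt_min x0.
have sE : 2 * s = Num.min x u by rewrite /s mulrCA divff// mulr1.
have := big s sp; rewrite sE ge_min lexx => /(_ isT).
apply/negP; rewrite -ltNge.
apply: (@le_lt_trans _ _ (M * u `^ a)).
  rewrite ler_pM2l// ge0_ler_powR ?nnegrE ?(ltW a0)//.
  - by rewrite -sE mulr_ge0// ltW.
  - by rewrite ltW.
  - by rewrite ge_min lexx orbT.
rewrite /u -powRrM mulVf ?gt_eqF// powRr1 ?invr_ge0 ?mulr_ge0 ?(ltW M0)//.
rewrite invfM mulrCA divff ?gt_eqF// mulr1; lra.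
Qed.

(** * Polynomials without zeros in the closed unit disc *)

Section weighted_norm.
Variable C : numFieldType.
Implicit Types (p q g : {poly C}) (r z : C).

(** Weighted l1-norm of the first [n] coefficients. *)
Definition wnorm r n p : C := \sum_(s < n) `|p`_s| * r ^+ s.

Lemma wnorm_ge0 r n p : 0 <= r -> 0 <= wnorm r n p.
Proof. by move=> r0; apply: sumr_ge0 => i _; rewrite mulr_ge0// exprn_ge0. Qed.

Lemma wnorm_scale r n c p : wnorm r n (c *: p) = `|c| * wnorm r n p.
Proof.
by rewrite /wnorm mulr_sumr; apply: eq_bigr => i _; rewrite coefZ normrM mulrA.
Qed.

Lemma wnormD_le r n p q : 0 <= r -> wnorm r n (p + q) <= wnorm r n p + wnorm r n q.
Proof.
move=> r0; rewrite /wnorm -big_split; apply: ler_sum => i _ /=.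
by rewrite coefD -mulrDl ler_wpM2r ?exprn_ge0// ler_normD.
Qed.

Lemma wnorm_sum_le r n (I : Type) (s : seq I) (F : I -> {poly C}) : 0 <= r ->
  wnorm r n (\sum_(i <- s) F i) <= \sum_(i <- s) wnorm r n (F i).
Proof.
move=> r0; elim: s => [|i s IH].
  by rewrite !big_nil /wnorm big1// => i _; rewrite coef0 normr0 mul0r.
by rewrite !big_cons (le_trans (wnormD_le _ _ _ r0))// lerD2l.
Qed.

Lemma wnormXM_le r n p : 0 <= r -> wnorm r n ('X * p) <= r * wnorm r n p.
Proof.
move=> r0; case: n => [|n]; first by rewrite /wnorm !big_ord0 mulr0.
rewrite /wnorm big_ord_recl coefXM/= normr0 mul0r add0r mulr_sumr big_ord_recr/=.
apply: ler_wpDr; first by rewrite !mulr_ge0// exprn_ge0.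
by apply: ler_sum => i _; rewrite coefXM/= exprS mulrCA.
Qed.

Lemma wnormXnM_le r n j p : 0 <= r -> wnorm r n ('X^j * p) <= r ^+ j * wnorm r n p.
Proof.
move=> r0; elim: j => [|j IH]; first by rewrite !expr0 !mul1r.
rewrite !exprS -!mulrA (le_trans (wnormXM_le _ _ r0))// ler_wpM2l//.
Qed.

Lemma wnorm_root_le r n z g : 0 <= r ->
  (`|z| - r) * wnorm r n g <= wnorm r n (('X - z%:P) * g).
Proof.
move=> r0; rewrite mulrBl lerBlDr.
have -> : `|z| * wnorm r n g = wnorm r n ((- 1) *: (('X - z%:P) * g) + 'X * g).
  rewrite -wnorm_scale; congr wnorm.
  by rewrite scaleN1r mulrBl opprB subrK mul_polyC.
rewrite (le_trans (wnormD_le _ _ _ r0))// wnorm_scale normrN1 mul1r lerD2l.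
exact: wnormXM_le.
Qed.

Lemma wnorm_prod_roots_le r n (rs : seq C) g : 0 <= r ->
  (forall z, z \in rs -> r < `|z|) ->
  (\prod_(z <- rs) (`|z| - r)) * wnorm r n g <=
  wnorm r n ((\prod_(z <- rs) ('X - z%:P)) * g).
Proof.
move=> r0; elim: rs g => [|z rs IH] g h; first by rewrite !big_nil !mul1r.
rewrite !big_cons -[X in _ <= X]/(wnorm r n (('X - z%:P) * _ * g)) -!mulrA.
apply: le_trans (wnorm_root_le _ _ _ r0).
rewrite ler_wpM2l//.
  by rewrite subr_ge0 ltW// h// mem_head.
by apply: IH => y ys; apply: h; rewrite inE ys orbT.
Qed.

End weighted_norm.

Section stable.
Variable R : rcfType.
Implicit Types F g : {poly R}.
Local Notation toC := (real_complex R).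

Lemma gt1_separation (rs : seq R[i]) : (forall z, z \in rs -> 1 < `|z|) ->
  exists2 r : R, 1 < r & forall z, z \in rs -> toC r < `|z|.
Proof.
elim: rs => [|z rs IH] h; first by exists 2 => //; rewrite ltr1n.
have [|r r1 hr] := IH; first by move=> y ys; apply: h; rewrite inE ys orbT.
have := h z (mem_head _ _); rewrite normc_def => z1.
set m : R := Num.sqrt _ in z1.
have {}z1 : 1 < m by rewrite -ltcR.
have m1 : 1 < (1 + m) / 2 by lra.
exists (Num.min r ((1 + m) / 2)); first by rewrite lt_min r1.
move=> y; rewrite inE => /predU1P[->|yrs].
  rewrite normc_def -/m ltcR; apply: le_lt_trans (_ : (1 + m) / 2 < m); last by lra.
  by rewrite ge_min lexx orbT.
apply: le_lt_trans (hr _ yrs); rewrite lecR ge_min lexx//.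
Qed.

(** If [F] has no zero in the closed unit disc, multiplication by [F] is bounded
    below in some exponentially weighted l1-norm: factor [F] over the complex
    numbers and take the weight below the moduli of all zeros. *)
Lemma stable_wnorm_le F :
  (forall z : R[i], `|z| <= 1 -> (map_poly toC F).[z] != 0) ->
  exists r : R, exists2 K : R, 1 < r & 0 <= K /\
    forall n g, wnorm r n g <= K * wnorm r n (F * g).
Proof.
move=> hF; have [rs Frs] := closed_field_poly_normal (map_poly toC F).
have F0 : map_poly toC F != 0.
  by apply: contraTneq (hF 0 _) => [->|]; rewrite ?horner0 ?eqxx// normr0.
have lc0 : lead_coef (map_poly toC F) != 0 by rewrite lead_coef_eq0.
have [z zrs|r r1 hr] := @gt1_separation rs.
  rewrite real_ltNge ?real1 ?normr_real//.
  apply/negP => /hF; rewrite Frs hornerZ mulf_eq0 negb_or => /andP[_].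
  by rewrite -/(root _ _) root_prod_XsubC zrs.
have rC0 : 0 <= toC r by rewrite lecR ltW// (lt_trans _ r1).
pose c : R[i] := `|lead_coef (map_poly toC F)| * \prod_(z <- rs) (`|z| - toC r).
have c0 : 0 < c.
  rewrite mulr_gt0 ?normr_gt0// big_seq prodr_gt0// => z zrs.
  by rewrite subr_gt0 hr.
have cE : c = toC (complex.Re c).
  by apply/eqP; rewrite eq_complex/= eqxx; have := c0; rewrite ltcE/= => /andP[].
have Rc0 : 0 < complex.Re c by rewrite -ltcR; move: c0; rewrite [X in 0 < X -> _]cE.
have wE n g : toC (wnorm r n g) = wnorm (toC r) n (map_poly toC g).
  rewrite /wnorm rmorph_sum; apply: eq_bigr => i _.
  by rewrite rmorphM rmorphXn/= coef_map/= normc_def/= expr0n/= addr0 sqrtr_sqr.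
exists r, (complex.Re c)^-1 => //; split; first by rewrite invr_ge0 ltW.
move=> n g; rewrite mulrC ler_pdivlMr// mulrC -lecR rmorphM/= -cE !wE.
rewrite rmorphM/= [X in _ <= wnorm _ _ (X * _)]Frs.
rewrite -[X in _ <= wnorm _ _ X]scalerAl wnorm_scale /c -mulrA ler_wpM2l//.
exact: wnorm_prod_roots_le.
Qed.

End stable.

(** A property of sets that is inherited by subsets and finite unions holds for a
    compact set as soon as it holds locally: otherwise the complements of the sets
    with this property generate a proper filter without cluster point. *)
Lemma compact_local_to_global (X : topologicalType) (A : set X) (Q : set X -> Prop) :
  compact A -> Q set0 -> (forall B C, B `<=` C -> Q C -> Q B) ->
  (forall B C, Q B -> Q C -> Q (B `|` C)) ->
  (forall x, A x -> exists2 U, nbhs x U & Q U) -> Q A.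
Proof.
move=> cA Q0 Qsub QU Qloc; apply: contrapT => nQA.
pose F : set_system X := [set S | Q (A `\` S)].
have FF : ProperFilter F.
  apply: Build_ProperFilter => [|].
    by rewrite /F/= setD0.
  split; rewrite /F/=.
  - by rewrite setDT.
  - move=> S S' QS QS'; apply: Qsub (QU _ _ QS QS') => z [Az /not_andP[nS|nS]].
      by left.
    by right.
  - by move=> S S' SS'; apply: Qsub; exact: setDS.
have FA : F A by rewrite /F/= setDv.
have [x [Ax clx]] := cA F FF FA.
have [U xU QUU] := Qloc x Ax.
have FU : F (~` U).
  by rewrite /F/= setDE setCK; apply: Qsub QUU => z [].
by have [z [nUz Uz]] := clx _ _ FU xU.
Qed.

Section inverse_decay.
Variable R : realType.

Lemma wnormM_le (r : R) n (p g : {poly R}) : 0 <= r ->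
  wnorm r n (p * g) <= wnorm r (size p) p * wnorm r n g.
Proof.
move=> r0; rewrite -{1}(coefK p) poly_def mulr_suml.
apply: le_trans (wnorm_sum_le _ _ _ r0) _.
rewrite {3}/wnorm mulr_suml; apply: ler_sum => i _.
by rewrite -scalerAl wnorm_scale -mulrA ler_wpM2l// wnormXnM_le.
Qed.



Variables (p1 p2 : nat).
Implicit Types eta : 'rV[R]_(p1 + p2).

(** The denominator of the transfer function from the noise to the residuals of
    the parameter [eta] when the true parameter is [eta0]. *)
Definition arma_denom (eta0 eta : 'rV[R]_(p1 + p2)) : {poly R} :=
  ar_poly eta0 * ma_poly eta.

Lemma arma_denom_stable eta0 eta (z : R[i]) :
  arma_admissible eta0 -> arma_admissible eta -> `|z| <= 1 ->
  (map_poly (real_complex R) (arma_denom eta0 eta)).[z] != 0.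
Proof.
move=> [h0 _ _] [h _ _] z1; rewrite rmorphM hornerM mulf_neq0//.
  by have [] := h0 z z1.
by have [] := h z z1.
Qed.

(** [stable_wnorm_le] at [eta1] persists nearby, as the perturbation of the
    polynomial can be absorbed into the left-hand side. *)
Lemma arma_denom_local eta0 eta1 : arma_admissible eta0 -> arma_admissible eta1 ->
  exists r : R, exists2 K : R, 1 < r & 0 <= K /\
  exists2 U, nbhs eta1 U & forall eta, U eta -> forall n g,
    wnorm r n g <= K * wnorm r n (arma_denom eta0 eta * g).
Proof.
move=> adm0 adm1.
have [r [K r1 [K0 hK]]] := stable_wnorm_le (fun z => @arma_denom_stable _ _ z adm0 adm1).
have r0 : 0 <= r by rewrite ltW// (lt_trans _ r1).
exists r, (2 * K) => //; split; first by rewrite mulr_ge0.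
pose D := wnorm r (size (ar_poly eta0)) (ar_poly eta0) * \sum_(j < p2) r ^+ j.+1.
have D0 : 0 <= D.
  by rewrite mulr_ge0 ?wnorm_ge0// sumr_ge0// => j _; rewrite exprn_ge0.
(* [K * D * del <= 1 / 2] *)
pose del := (2 * (K * D + 1))^-1.
have KD : 0 < K * D + 1 by rewrite ltr_wpDl// mulr_ge0.
have del0 : 0 < del by rewrite invr_gt0 mulr_gt0.
exists (ball eta1 del); first exact: nbhsx_ballx.
move=> eta [_ hball] n g.
pose Del := ar_poly eta0 * (ma_poly eta - ma_poly eta1).
have FE : arma_denom eta0 eta1 * g = arma_denom eta0 eta * g + (- 1) *: (Del * g).
  by rewrite /arma_denom /Del scaleN1r; ring.
have DelE : ma_poly eta - ma_poly eta1 =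
    \sum_(j < p2) (ma_coef eta1 j - ma_coef eta j) *: 'X^(j.+1).
  rewrite /ma_poly opprB addrC addrA subrK -sumrB.
  by apply: eq_bigr => j _; rewrite scalerBl.
have hDel : wnorm r n (Del * g) <= D * del * wnorm r n g.
  rewrite /Del -[_ * g]mulrA; apply: le_trans (wnormM_le _ _ _ r0) _.
  rewrite /D -!mulrA ler_wpM2l ?wnorm_ge0// DelE mulr_suml.
  apply: le_trans (wnorm_sum_le _ _ _ r0) _; rewrite mulr_suml.
  apply: ler_sum => j _; rewrite -scalerAl wnorm_scale mulrCA.
  apply: ler_pM; rewrite ?normr_ge0 ?wnorm_ge0//; last exact: wnormXnM_le.
  by apply: ltW; exact: hball.
have h1 := hK n g; rewrite FE in h1.
have {}h1 := le_trans h1 (ler_wpM2l K0 (wnormD_le _ _ _ r0)).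
rewrite wnorm_scale normrN1 mul1r mulrDr in h1.
have h2 := ler_wpM2l K0 hDel.
have h3 : K * (D * del * wnorm r n g) <= wnorm r n g / 2.
  rewrite mulrA mulrA [leRHS]mulrC ler_wpM2r ?wnorm_ge0// /del.
  rewrite invfM mulrCA ler_piMr// ler_pdivrMr// mul1r lerDl.
  exact: ler01.
lra.
Qed.

(** Uniformly over a compact set of admissible parameters, the power series
    inverse of [arma_denom eta0 eta] has exponentially decaying coefficients; here
    [H] is any polynomial that represents this inverse modulo ['X^n]. *)
Lemma arma_denom_inverse_decay (A : set 'rV[R]_(p1 + p2)) eta0 :
  compact A -> arma_admissible eta0 -> (forall eta, A eta -> arma_admissible eta) ->
  exists r : R, exists2 K : R, 1 < r & 0 <= K /\
  forall eta, A eta -> forall n (H : {poly R}),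
    (forall t, (t < n)%N -> (arma_denom eta0 eta * H)`_t = (t == 0%N)%:R) ->
    forall s, (s < n)%N -> `|H`_s| <= K * r^-1 ^+ s.
Proof.
move=> cA adm0 adm.
pattern A; apply: (compact_local_to_global cA).
- by exists 2, 0; [lra|split].
- move=> B C BC [r [K r1 [K0 h]]]; exists r, K => //; split => // eta Beta.
  exact/h/BC.
- move=> B C [r [K r1 [K0 h]]] [r' [K' r1' [K0' h']]].
  exists (Num.min r r'), (Num.max K K'); first by rewrite lt_min r1.
  split; first by rewrite le_max K0.
  have dec (x y a b : R) s : 0 <= a -> a <= b -> 1 < x -> x <= y ->
      a * y^-1 ^+ s <= b * x^-1 ^+ s.
    move=> a0 ab x1 xy; have x0 : 0 < x by rewrite (lt_trans _ x1).
    apply: ler_pM => //; first by rewrite exprn_ge0 ?invr_ge0// ltW// (lt_le_trans x0).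
    rewrite lerXn2r ?nnegrE ?invr_ge0 ?(ltW x0)//; last by rewrite lef_pV2 ?posrE// (lt_le_trans x0).
    by rewrite ltW// (lt_le_trans x0).
  have m1 : 1 < Num.min r r' by rewrite lt_min r1.
  move=> eta [Be|Ce] n H hH s sn.
    apply: le_trans (h _ Be n H hH s sn) _; apply: dec => //.
      by rewrite le_max lexx.
    by rewrite ge_min lexx.
  apply: le_trans (h' _ Ce n H hH s sn) _; apply: dec => //.
    by rewrite le_max lexx orbT.
  by rewrite ge_min lexx orbT.
- move=> eta1 /adm adm1.
  have [r [K r1 [K0 [U U1 hU]]]] := arma_denom_local adm0 adm1.
  have r0 : 0 < r by rewrite (lt_trans _ r1).
  exists U => //; exists r, K => //; split => // eta Ueta n H hH s sn.
  rewrite exprVn -[_ * _]/(_ / _) ler_pdivlMr ?exprn_gt0//.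
  have qE m : (forall t, (t < m)%N -> (arma_denom eta0 eta * H)`_t = (t == 0%N)%:R) ->
      wnorm r m (arma_denom eta0 eta * H) = (0 < m)%:R.
    case: m => [|m] hm; first by rewrite /wnorm big_ord0.
    rewrite /wnorm big_ord_recl hm// expr0 mulr1 normr1 big1 ?addr0// => i _.
    by rewrite hm; [rewrite normr0 mul0r|exact: ltn_ord (lift ord0 i)].
  have := hU eta Ueta n H; rewrite (qE _ hH).
  rewrite (leq_ltn_trans _ sn)// mulr1; apply: le_trans.
  rewrite /wnorm (bigD1 (Ordinal sn))//= lerDl sumr_ge0// => i _.
  by rewrite mulr_ge0// exprn_ge0// ltW.
Qed.

Lemma compact_entries_bounded (A : set 'rV[R]_(p1 + p2)) : compact A ->
  exists2 K : R, 0 <= K & forall eta, A eta -> forall i, `|eta 0 i| <= K.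
Proof.
move=> cA; pattern A; apply: (compact_local_to_global cA).
- by exists 0.
- by move=> B C BC [K K0 h]; exists K => // eta /BC; exact: h.
- move=> B C [K K0 h] [K' K0' h']; exists (Num.max K K'); first by rewrite le_max K0.
  move=> eta [/h|/h'] {}h i; apply: le_trans (h i) _; rewrite le_max lexx ?orbT//.
- move=> eta1 _; exists (ball eta1 1); first exact: nbhsx_ballx.
  exists (1 + \sum_i `|eta1 0 i|); first by rewrite addr_ge0// sumr_ge0.
  move=> eta [_ h] i.
  have -> : eta 0 i = - (eta1 0 i - eta 0 i) + eta1 0 i by rewrite opprB subrK.
  apply: le_trans (ler_normD _ _) _; rewrite normrN; apply: lerD.
    by apply: ltW; exact: h.
  by rewrite (bigD1 i)//= lerDl sumr_ge0.
Qed.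

End inverse_decay.

(** * Residuals as truncated power series *)

Section truncated.
Variable R : realType.
Implicit Types (p q F : {poly R}) (x : nat -> R).

(** Congruence modulo ['X^n]. *)
Definition eq_upto n p q := forall t, (t < n)%N -> p`_t = q`_t.

Lemma eq_upto_refl n p : eq_upto n p p.
Proof. by []. Qed.

Lemma eq_uptoM n p p' q q' : eq_upto n p p' -> eq_upto n q q' ->
  eq_upto n (p * q) (p' * q').
Proof.
move=> hp hq t tn; rewrite !coefM; apply: eq_bigr => i _.
by rewrite hp ?hq//; have := ltn_ord i; lia.
Qed.

Lemma eq_uptoB n p p' q q' : eq_upto n p p' -> eq_upto n q q' ->
  eq_upto n (p - q) (p' - q').
Proof. by move=> hp hq t tn; rewrite !coefB hp// hq. Qed.

Lemma truncated_inverse n F : F`_0 != 0 -> exists H : {poly R}, eq_upto n (F * H) 1.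
Proof.
move=> F0.
have cF : coprimep F ('X^n) by rewrite coprimep_expr// coprimepX /root horner_coef0.
have /Bezout_eq1_coprimepP[[u v] /= uv] := cF.
exists u => t tn; rewrite -uv coefD coefMXn tn addr0 mulrC.
by [].
Qed.

(** Truncated generating polynomial of a sequence. *)
Definition series_trunc n x : {poly R} := \poly_(t < n) x t.

Lemma coef_series_shift n x k t : x 0%N = 0 -> (t < n)%N ->
  ('X^k * series_trunc n x)`_t = x (t - k)%N.
Proof.
move=> x0 tn; rewrite coefXnM coef_poly; case: ltnP => [tk|kt].
  by rewrite (_ : (t - k)%N = 0%N) ?x0//; lia.
by rewrite (leq_ltn_trans _ tn)// leq_subr.
Qed.

Lemma coef_lag_poly n x m (a : 'I_m -> R) t : x 0%N = 0 -> (t < n)%N ->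
  ((1 - \sum_(j < m) a j *: 'X^(j.+1)) * series_trunc n x)`_t =
  x t - \sum_(j < m) a j * x (t - j.+1)%N.
Proof.
move=> x0 tn; rewrite mulrBl mul1r coefB coef_poly tn mulr_suml coef_sum.
congr (_ - _); apply: eq_bigr => j _.
by rewrite -scalerAl coefZ coef_series_shift.
Qed.

End truncated.

Section residual_series.
Variables (R : realType) (p1 p2 : nat).
Implicit Types (eta : 'rV[R]_(p1 + p2)) (y e : nat -> R).

(** The defining recursion of the residuals as an identity of power series. *)
Lemma ar_poly_resid eta y n : y 0%N = 0 ->
  eq_upto n (ar_poly eta * series_trunc n y)
            (ma_poly eta * series_trunc n (resid eta y)).
Proof.
move=> y0 t tn; rewrite !coef_lag_poly//.
case: t tn => [|t] tn.
  by rewrite y0 resid0 !big1// => j _; rewrite ?sub0n ?resid0 ?y0 mulr0.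
rewrite [in RHS]residE// /arma_g /arma_rhs; ring.
Qed.

(** The numerator of the transfer function from the noise to
    [resid eta - resid eta0]; its denominator is [arma_denom eta0 eta]. *)
Definition arma_numer (eta0 eta : 'rV[R]_(p1 + p2)) : {poly R} :=
  ar_poly eta * ma_poly eta0 - ar_poly eta0 * ma_poly eta.

Lemma denom_resid_diff eta0 eta y e n : y 0%N = 0 -> e 0%N = 0 ->
  (forall t, (0 < t)%N -> y t = arma_rhs eta0 y e t + e t) ->
  eq_upto n
    (arma_denom eta0 eta * series_trunc n (fun t => resid eta y t - e t))
    (arma_numer eta0 eta * series_trunc n e).
Proof.
move=> y0 e0 ye.
have re : resid eta0 y = e by apply/funext; exact: resid_true.
have h0 := @ar_poly_resid eta0 y n y0; rewrite re in h0.
have h := @ar_poly_resid eta y n y0.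
have h1 := eq_uptoB (eq_uptoM (@eq_upto_refl _ n (ar_poly eta)) h0) (eq_uptoM (@eq_upto_refl _ n (ar_poly eta0)) h).
have DE : series_trunc n (fun t => resid eta y t - e t) =
    series_trunc n (resid eta y) - series_trunc n e.
  by apply/polyP => i; rewrite coefB !coef_poly; case: ifP; rewrite ?subr0.
move=> t tn; have := h1 t tn; rewrite DE /arma_denom /arma_numer.
set E := series_trunc n e; set Y := series_trunc n y; set S := series_trunc n _.
have -> : ar_poly eta * (ar_poly eta0 * Y) - ar_poly eta0 * (ar_poly eta * Y) = 0 by ring.
rewrite coef0 => hz; apply/eqP; rewrite -subr_eq0 -coefB.
rewrite (_ : _ - _ = - (ar_poly eta * (ma_poly eta0 * E) - ar_poly eta0 * (ma_poly eta * S))).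
  by rewrite coefN -hz oppr0.
ring.
Qed.

Lemma ar_poly0 eta : (ar_poly eta)`_0 = 1.
Proof.
rewrite coefB coef1 coef_sum big1 ?subr0// => j _.
by rewrite coefZ coefXn mulr0.
Qed.

Lemma ma_poly0 eta : (ma_poly eta)`_0 = 1.
Proof.
rewrite coefB coef1 coef_sum big1 ?subr0// => j _.
by rewrite coefZ coefXn mulr0.
Qed.

Lemma size_lag_sum m (a : 'I_m -> R) : (size (\sum_(j < m) a j *: 'X^(j.+1))%R <= m.+1)%N.
Proof.
apply: (leq_trans (size_sum _ _ _)); apply/bigmax_leqP => j _.
by rewrite (leq_trans (size_scale_leq _ _))// size_polyXn ltnS.
Qed.

Lemma coef_lag_sum m (a : 'I_m -> R) (j : 'I_m) :
  (\sum_(i < m) a i *: 'X^(i.+1))`_j.+1 = a j.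
Proof.
rewrite coef_sum (bigD1 j)//= coefZ coefXn eqxx mulr1 big1 ?addr0// => i ij.
by rewrite coefZ coefXn eqSS eq_sym (negbTE (_ : (i : nat) != j)) ?mulr0.
Qed.

Lemma size_ar_poly eta : (size (ar_poly eta) <= p1.+1)%N.
Proof.
apply: (leq_trans (size_polyD _ _)); rewrite geq_max size_poly1 size_polyN.
exact: size_lag_sum.
Qed.

Lemma size_ma_poly eta : (size (ma_poly eta) <= p2.+1)%N.
Proof.
apply: (leq_trans (size_polyD _ _)); rewrite geq_max size_poly1 size_polyN.
exact: size_lag_sum.
Qed.

Lemma size_polyM_leq (p q : {poly R}) m n : (size p <= m.+1)%N -> (size q <= n.+1)%N ->
  (size (p * q)%R <= (m + n).+1)%N.
Proof. by move=> hp hq; have := size_polyMleq p q; lia. Qed.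

Lemma size_arma_numer eta0 eta : (size (arma_numer eta0 eta) <= (p1 + p2).+1)%N.
Proof.
apply: (leq_trans (size_polyD _ _)); rewrite geq_max size_polyN.
by rewrite !size_polyM_leq// ?size_ar_poly ?size_ma_poly.
Qed.

Lemma arma_numer0 eta0 eta : (arma_numer eta0 eta)`_0 = 0.
Proof. by rewrite coefB !coef0M !ar_poly0 !ma_poly0 subrr. Qed.

Lemma arma_denom0 eta0 eta : (arma_denom eta0 eta)`_0 = 1.
Proof. by rewrite coef0M ar_poly0 ma_poly0 mulr1. Qed.

Lemma arma_numerE eta0 eta : arma_numer eta0 eta =
  \sum_(j < p1 + p2) (arma_numer eta0 eta)`_j.+1 *: 'X^(j.+1).
Proof.
apply/polyP => i; case: i => [|i].
  rewrite arma_numer0 coef_sum big1// => j _.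
  by rewrite coefZ coefXn mulr0.
have [ip|pi] := ltnP i (p1 + p2); first by rewrite (coef_lag_sum _ (Ordinal ip)).
rewrite nth_default ?(leq_trans (size_arma_numer _ _))//.
rewrite nth_default// (leq_trans (size_lag_sum _))//.
Qed.

End residual_series.

(** * Identifiability *)

Section identifiability.
Variables (R : realType) (p1 p2 : nat) (eta0 : 'rV[R]_(p1 + p2)).
Hypothesis adm : arma_admissible eta0.
Implicit Types v : 'rV[R]_(p1 + p2).

Let ar_part v : {poly R} := \sum_(j < p1) v 0 (lshift p2 j) *: 'X^j.
Let ma_part v : {poly R} := \sum_(j < p2) v 0 (rshift p1 j) *: 'X^j.
Let numer_lin v : {poly R} := ma_part v * ar_poly eta0 - ar_part v * ma_poly eta0.

Let arma_numer_lin eta : arma_numer eta0 eta = 'X * numer_lin (eta - eta0).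
Proof.
rewrite /arma_numer; have -> : ar_poly eta = ar_poly eta0 - 'X * ar_part (eta - eta0).
  rewrite /ar_poly -addrA -opprD; congr (1 - _); rewrite mulr_sumr -big_split/=.
  apply: eq_bigr => j _; rewrite -scalerAr -exprS -scalerDl; congr (_ *: _).
  by rewrite /ar_coef !mxE; ring.
have -> : ma_poly eta = ma_poly eta0 - 'X * ma_part (eta - eta0).
  rewrite /ma_poly -addrA -opprD; congr (1 - _); rewrite mulr_sumr -big_split/=.
  apply: eq_bigr => j _; rewrite -scalerAr -exprS -scalerDl; congr (_ *: _).
  by rewrite /ma_coef !mxE; ring.
by rewrite /numer_lin; ring.
Qed.

Let coprime_ar_ma : coprimep (ar_poly eta0) (ma_poly eta0).
Proof.
case: adm => _ h _; rewrite -(coprimep_map (real_complex R)).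
apply/Pdiv.ClosedField.coprimepP => z rz; apply/negP => rz'.
by apply: (h z); split.
Qed.

Let leading_coef_neq0 : (exists2 j : 'I_p1, j.+1 = p1 & ar_coef eta0 j != 0) \/
  (exists2 j : 'I_p2, j.+1 = p2 & ma_coef eta0 j != 0).
Proof.
case: adm => _ _ h; apply: contrapT => /not_orP[h1 h2]; move: h.
rewrite !big1 ?addr0 ?ltxx// => j /eqP jp; apply/eqP; rewrite normr_eq0;
  apply/negPn/negP => nz.
  by apply: h2; exists j.
by apply: h1; exists j.
Qed.

Let size_part m (a : 'I_m -> R) : (size (\sum_(j < m) a j *: 'X^j)%R <= m)%N.
Proof.
apply: (leq_trans (size_sum _ _ _)); apply/bigmax_leqP => j _.
by rewrite (leq_trans (size_scale_leq _ _))// size_polyXn.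
Qed.

Let coef_part m (a : 'I_m -> R) (j : 'I_m) : (\sum_(i < m) a i *: 'X^i)`_j = a j.
Proof.
rewrite coef_sum (bigD1 j)//= coefZ coefXn eqxx mulr1 big1 ?addr0// => i ij.
by rewrite coefZ coefXn eq_sym (negbTE (_ : (i : nat) != j)) ?mulr0.
Qed.

Let poly_neq0 (p : {poly R}) : p`_0 = 1 -> p != 0.
Proof. by move=> p0; apply: contra_eq_neq p0 => ->; rewrite coef0 eq_sym oner_neq0. Qed.

Let numer_lin_inj v : numer_lin v = 0 -> v = 0.
Proof.
move/eqP; rewrite subr_eq0 => /eqP hab.
have [A10 A20] : ar_poly eta0 != 0 /\ ma_poly eta0 != 0.
  by split; apply: poly_neq0; rewrite ?ar_poly0 ?ma_poly0.
suff [ha hb] : ar_part v = 0 /\ ma_part v = 0.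
  apply/rowP => i; rewrite mxE; case: (split_ordP i) => j ->.
    by rewrite -(coef_part (fun j => v 0 (lshift p2 j))) -/(ar_part v) ha coef0.
  by rewrite -(coef_part (fun j => v 0 (rshift p1 j))) -/(ma_part v) hb coef0.
have [[j jp nz]|[j jp nz]] := leading_coef_neq0.
  have ha : ar_part v = 0.
    apply: contraNeq nz => ha.
    have d : ar_poly eta0 %| ar_part v.
      by rewrite -(Gauss_dvdpl _ coprime_ar_ma) -hab dvdp_mull.
    have : (ar_poly eta0)`_j.+1 = 0.
      apply: nth_default; rewrite jp; apply: leq_trans (size_part _).
      exact: dvdp_leq ha d.
    rewrite coefB coef1/= sub0r (coef_lag_sum (ar_coef eta0)) => /eqP.
    by rewrite oppr_eq0.
  split => //; move: hab; rewrite ha mul0r => /eqP; rewrite mulf_eq0 (negbTE A10) orbF.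
  by move/eqP.
have hb : ma_part v = 0.
  apply: contraNeq nz => hb.
  have d : ma_poly eta0 %| ma_part v.
    rewrite -(Gauss_dvdpl _ (_ : coprimep _ (ar_poly eta0))); first by rewrite hab dvdp_mull.
    by rewrite coprimep_sym.
  have : (ma_poly eta0)`_j.+1 = 0.
    apply: nth_default; rewrite jp; apply: leq_trans (size_part _).
    exact: dvdp_leq hb d.
  rewrite coefB coef1/= sub0r (coef_lag_sum (ma_coef eta0)) => /eqP.
  by rewrite oppr_eq0.
split => //; move: hab; rewrite hb mul0r => /esym/eqP; rewrite mulf_eq0 (negbTE A20) orbF.
by move/eqP.
Qed.

Let numer_row v : 'rV[R]_(p1 + p2) := \row_j (numer_lin v)`_j.

Let numer_row_linear : linear numer_row.
Proof.
move=> a u v; apply/rowP => j; rewrite !mxE -coefZ -coefD.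
suff -> : numer_lin (a *: u + v) = a *: numer_lin u + numer_lin v by [].
have partE m (f : 'I_m -> 'I_(p1 + p2)) :
    \sum_(i < m) (a *: u + v) 0 (f i) *: 'X^i =
    a *: (\sum_(i < m) u 0 (f i) *: 'X^i) + \sum_(i < m) v 0 (f i) *: 'X^i :> {poly R}.
  rewrite scaler_sumr -big_split/=; apply: eq_bigr => i _.
  by rewrite !mxE scalerDl scalerA.
rewrite /numer_lin /ma_part /ar_part !partE -!mul_polyC; ring.
Qed.

HB.instance Definition _ := GRing.isLinear.Build R _ _ _ numer_row numer_row_linear.

(** Coprimality together with the non-vanishing of one of the two leading
    coefficients makes the linear map from [eta - eta0] to [arma_numer eta0 eta]
    injective, hence bounded below. *)
Lemma arma_numer_lower_bound : exists2 K : R, 0 <= K & forall eta i,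
  `|(eta - eta0) 0 i| <= K * \sum_(j < p1 + p2) `|(arma_numer eta0 eta)`_j.+1|.
Proof.
have /row_freeP[B LB] : row_free (lin1_mx numer_row).
  apply: inj_row_free => v; rewrite mul_rV_lin1 /= => hv; apply: numer_lin_inj.
  apply/polyP => i; rewrite coef0.
  have [ip|pi] := ltnP i (p1 + p2).
    by have /rowP/(_ (Ordinal ip)) := hv; rewrite !mxE.
  have arith (m x y z : nat) : (x <= m)%N -> (y <= z.+1)%N -> ((x + y).-1 <= z + m)%N.
    lia.
  apply: nth_default; apply: leq_trans pi.
  apply: (leq_trans (size_polyD _ _)); rewrite geq_max size_polyN.
  apply/andP; split; apply: (leq_trans (size_polyMleq _ _)).
    by apply: arith; [exact: size_part|exact: size_ar_poly].
  by rewrite [leqRHS]addnC; apply: arith;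
    [exact: size_part|exact: size_ma_poly].
exists (\sum_i \sum_j `|B i j|); first by rewrite sumr_ge0// => i _; rewrite sumr_ge0.
move=> eta i; set v := eta - eta0.
have -> : v 0 i = (numer_row v *m B) 0 i.
  by rewrite -[numer_row v]/(numer_row v) -mul_rV_lin1 -mulmxA LB mulmx1.
rewrite mxE; apply: le_trans (ler_norm_sum _ _ _) _; rewrite mulr_sumr.
apply: ler_sum => j _; rewrite normrM mulrC mxE arma_numer_lin coefXM/= -/v.
rewrite ler_wpM2r//.
rewrite (bigD1 j)//= (bigD1 i)//= -addrA lerDl addr_ge0// sumr_ge0// => k _.
by rewrite sumr_ge0.
Qed.

End identifiability.

(** * The deterministic bound on the estimation error *)

Section weighted_means.
Variable R : realFieldType.

Lemma expr_tangent_le (p : nat) (a x : R) : 0 <= a -> 0 <= x ->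
  a ^+ p.+1 + p.+1%:R * a ^+ p * (x - a) <= x ^+ p.+1.
Proof.
move=> a0 x0; elim: p => [|p IH]; first by rewrite !expr1 expr0; lra.
rewrite [leRHS]exprS; apply: le_trans (ler_wpM2l x0 IH).
rewrite -subr_ge0 (_ : _ - _ = p.+1%:R * a ^+ p * (x - a) ^+ 2).
  by apply: mulr_ge0; [apply: mulr_ge0 => //; exact: exprn_ge0|exact: sqr_ge0].
by rewrite !exprS -[p.+2]addn1 natrD; ring.
Qed.

(** Jensen's inequality for powers and unnormalized weights. *)
Lemma weighted_power_mean (I : finType) (w x : I -> R) (p : nat) :
  (forall i, 0 <= w i) -> (forall i, 0 <= x i) ->
  (\sum_i w i * x i) ^+ p.+1 <= (\sum_i w i) ^+ p * \sum_i w i * x i ^+ p.+1.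
Proof.
move=> w0 x0; set W := \sum_i w i; set S := \sum_i _ * _.
have W0 : 0 <= W by exact: sumr_ge0.
have S0 : 0 <= S by apply: sumr_ge0 => i _; rewrite mulr_ge0.
have [WE|Wn] := eqVneq W 0.
  have wi i : w i = 0.
    by move/eqP: WE; rewrite psumr_eq0// => /allP/(_ i); rewrite mem_index_enum => /(_ isT)/eqP.
  rewrite /S big1 => [|i _]; last by rewrite wi mul0r.
  by rewrite expr0n/= mulr_ge0 ?exprn_ge0// sumr_ge0// => i _; rewrite wi mul0r.
have Wp : 0 < W by rewrite lt_def Wn.
pose a := S / W.
have a0 : 0 <= a by rewrite divr_ge0.
have SE : S = W * a by rewrite /a mulrCA divff// mulr1.
have : W * a ^+ p.+1 <= \sum_i w i * x i ^+ p.+1.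
  apply: (@le_trans _ _ (\sum_i w i * (a ^+ p.+1 + p.+1%:R * a ^+ p * (x i - a)))).
    rewrite (_ : (\sum_i _) = W * a ^+ p.+1 + p.+1%:R * a ^+ p * (S - W * a)).
      by rewrite SE subrr mulr0 addr0.
    rewrite /W /S !mulr_suml -sumrB mulr_sumr -big_split/=.
    by apply: eq_bigr => i _; ring.
  by apply: ler_sum => i _; rewrite ler_wpM2l// expr_tangent_le.
move/(ler_wpM2l (exprn_ge0 p W0)); apply: le_trans.
by rewrite SE exprMn exprSr -mulrA.
Qed.

Lemma sqr_sum_le (I : finType) (w x : I -> R) :
  (\sum_i w i * x i) ^+ 2 <= (\sum_i `|w i|) * \sum_i `|w i| * x i ^+ 2.
Proof.
apply: (@le_trans _ _ ((\sum_i `|w i| * `|x i|) ^+ 2)).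
  rewrite -real_normK ?num_real//; apply: lerXn2r; rewrite ?nnegrE//.
    by apply: sumr_ge0 => i _; rewrite mulr_ge0.
  apply: le_trans (ler_norm_sum _ _ _) _.
  by apply: ler_sum => i _; rewrite normrM.
have := @weighted_power_mean I (fun i => `|w i|) (fun i => `|x i|) 1
  (fun i => normr_ge0 _) (fun i => normr_ge0 _).
rewrite expr1; congr (_ <= _ * _); apply: eq_bigr => i _.
by rewrite real_normK ?num_real.
Qed.

End weighted_means.

Section filtering.
Variable R : realFieldType.
Implicit Types (F D : {poly R}).

Lemma sum_coefXn_sqr_le n i D :
  \sum_(t < n) ('X^i * D)`_t ^+ 2 <= \sum_(t < n) D`_t ^+ 2.
Proof.
elim: i => [|i IH]; first by rewrite expr0 mul1r.
apply: le_trans IH; rewrite exprS -mulrA; set q := 'X^i * D.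
case: n => [|n]; first by rewrite !big_ord0.
rewrite big_ord_recl coefXM/= expr0n add0r [leRHS]big_ord_recr/=.
rewrite ler_wpDr ?sqr_ge0//.
by apply: ler_sum => j _; rewrite coefXM.
Qed.

(** Young's inequality: the l2-norm of a filtered sequence. *)
Lemma filter_sqr_sum_le n F D :
  \sum_(t < n) (F * D)`_t ^+ 2 <=
  (\sum_(i < size F) `|F`_i|) ^+ 2 * \sum_(t < n) D`_t ^+ 2.
Proof.
set W := \sum_(i < size F) _; pose S := \sum_(t < n) D`_t ^+ 2.
have W0 : 0 <= W by apply: sumr_ge0.
apply: (@le_trans _ _ (\sum_(t < n) W * \sum_(i < size F) `|F`_i| * ('X^i * D)`_t ^+ 2)).
  apply: ler_sum => t _; rewrite -[X in X * D](coefK F) poly_def mulr_suml coef_sum.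
  under eq_bigr do rewrite -scalerAl coefZ.
  exact: sqr_sum_le.
rewrite -mulr_sumr expr2 -mulrA ler_wpM2l// exchange_big/= mulr_suml.
by apply: ler_sum => i _; rewrite -mulr_sumr ler_wpM2l// sum_coefXn_sqr_le.
Qed.

End filtering.

Section euclidean_norm.
Variables (R : realType) (m : nat).
Implicit Types v : 'rV[R]_m.

Lemma sqr_enorm v : enorm v ^+ 2 = \sum_(i < m) v 0 i ^+ 2.
Proof. by rewrite sqr_sqrtr// sumr_ge0// => i _; exact: sqr_ge0. Qed.

Lemma enorm_ge0 v : 0 <= enorm v.
Proof. exact: sqrtr_ge0. Qed.

Lemma le_enorm v i : `|v 0 i| <= enorm v.
Proof.
rewrite -[leLHS]ger0_norm// -sqrtr_sqr ler_wsqrtr// real_normK ?num_real//.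
by rewrite (bigD1 i)//= lerDl sumr_ge0// => j _; exact: sqr_ge0.
Qed.

Lemma enorm_le_sum v : enorm v <= \sum_(i < m) `|v 0 i|.
Proof.
have s0 : 0 <= \sum_(i < m) `|v 0 i| by exact: sumr_ge0.
rewrite -(ler_pXn2r (n := 2))// ?nnegrE ?enorm_ge0// sqr_enorm.
rewrite expr2 mulr_suml; apply: ler_sum => i _.
rewrite -real_normK ?num_real// expr2 ler_wpM2l//.
by rewrite (bigD1 i)//= lerDl sumr_ge0.
Qed.

Lemma enormZ (a : R) v : enorm (a *: v) = `|a| * enorm v.
Proof.
rewrite -[`|a|]sqrtr_sqr -sqrtrM ?sqr_ge0//.
by congr Num.sqrt; rewrite mulr_sumr; apply: eq_bigr => i _; rewrite mxE exprMn.
Qed.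

End euclidean_norm.

Section covariance_sums.
Variable R : realType.
Implicit Types (rho : R) (e : nat -> R) (p n : nat).

(** Centred sample covariance, not divided by the sample size. *)
Definition cov_sum (s2 : R) e i j n : R := \sum_(t < n) centred_prod s2 e i j t.

(** Deviation of the Gram matrix of the [p] lagged noise vectors from its mean. *)
Definition gram_dev (s2 : R) p e n : R :=
  \sum_(ij : 'I_p * 'I_p) `|cov_sum s2 e ij.1.+1 ij.2.+1 n|.

(** Exponentially weighted sum of the sample covariances of the noise with its
    past. *)
Definition cross_sum (s2 : R) rho p e n : R :=
  \sum_(js : 'I_p * 'I_n.+1) rho ^+ js.2 * `|cov_sum s2 e 0 (js.1.+1 + js.2) n|.

Lemma lag_prodE (s2 : R) e i j t : e 0%N = 0 ->
  e (t.+1 - i.+1)%N * e (t.+1 - j.+1)%N =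
  centred_prod s2 e i.+1 j.+1 t + (if i == j then (i < t)%N%:R * s2 else 0).
Proof.
move=> e0; rewrite /centred_prod eqSS; case: eqP => [->|_]; last by rewrite addr0.
case: ltnP => tj; first by rewrite mul1r subrK expr2.
by rewrite subSS (_ : (t - j)%N = 0%N) ?e0 ?mul0r ?addr0//; lia.
Qed.

Lemma sum_ltn_ord n i : (\sum_(t < n) (i < t)%N)%N = (n - i.+1)%N.
Proof.
elim: n => [|n IH]; first by rewrite big_ord0.
by rewrite big_ord_recr/= IH; case: ltnP; lia.
Qed.

(** The Gram matrix of the lagged noise is bounded below by [s2 * n / 2] up to
    [gram_dev]; at lag [i.+1] there are [n - i.+1] non-vanishing summands, at least
    [n / 2] because of [2 * p <= n]. *)
Lemma gram_lower_bound (s2 : R) e p n (c : 'I_p -> R) : e 0%N = 0 -> 0 <= s2 ->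
  (2 * p <= n)%N ->
  (s2 * n%:R / 2 - gram_dev s2 p e n) * (\sum_j c j ^+ 2) <=
  \sum_(t < n) (\sum_j c j * e (t.+1 - j.+1)%N) ^+ 2.
Proof.
move=> e0 s20 pn; set c2 := \sum_j c j ^+ 2.
have -> : \sum_(t < n) (\sum_j c j * e (t.+1 - j.+1)%N) ^+ 2 =
    \sum_i \sum_j c i * c j * cov_sum s2 e i.+1 j.+1 n +
    \sum_i c i ^+ 2 * (s2 * (n - i.+1)%:R).
  transitivity (\sum_(t < n) \sum_i \sum_j (c i * c j * centred_prod s2 e i.+1 j.+1 t +
      c i * c j * (if i == j then (i < t)%N%:R * s2 else 0))).
    apply: eq_bigr => t _; rewrite expr2 mulr_suml; apply: eq_bigr => i _.
    rewrite mulr_sumr; apply: eq_bigr => j _.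
    by rewrite mulrACA (lag_prodE s2) ?mulrDr// -val_eqE.
  rewrite exchange_big/= -big_split/=; apply: eq_bigr => i _.
  rewrite exchange_big/=.
  transitivity (\sum_j (c i * c j * cov_sum s2 e i.+1 j.+1 n +
     (if i == j then c i * c j * (s2 * (n - i.+1)%:R) else 0))).
    apply: eq_bigr => j _; rewrite big_split/= -mulr_sumr; congr (_ + _).
    case: eqP => _; last by rewrite mulr0 big1.
    by rewrite -mulr_sumr -mulr_suml -natr_sum sum_ltn_ord [s2 * _]mulrC.
  rewrite big_split/=; congr (_ + _).
  rewrite -big_mkcond/= (big_pred1 i) ?expr2// => j; exact: eq_sym.
rewrite mulrBl addrC; apply: lerD; last first.
  rewrite /c2 mulr_sumr; apply: ler_sum => i _; rewrite mulrC ler_wpM2l ?sqr_ge0//.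
  rewrite -mulrA ler_wpM2l// ler_pdivrMr// -natrM ler_nat.
  have := ltn_ord i; lia.
rewrite lerNl pair_bigA/= -sumrN /gram_dev mulr_suml; apply: ler_sum => -[i j] _ /=.
apply: le_trans (ler_norm _) _; rewrite normrN normrM mulrC ler_wpM2l//.
have ci k : c k ^+ 2 <= c2 by rewrite /c2 (bigD1 k)//= lerDl sumr_ge0// => l _; exact: sqr_ge0.
have [ij|/ltW ij] := leP `|c i| `|c j|.
  apply: le_trans (ci j); rewrite normrM -[leRHS]real_normK ?num_real// expr2.
  by rewrite ler_wpM2r.
apply: le_trans (ci i); rewrite normrM -[leRHS]real_normK ?num_real// expr2.
by rewrite ler_wpM2l.
Qed.

(** The cross term of the least squares objective. *)
Lemma cross_upper_bound (s2 : R) e p n (c : 'I_p -> R) (H D : {poly R})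
    (K s rho : R) :
  e 0%N = 0 -> 0 <= K -> 0 <= rho -> (forall j, `|c j| <= s) ->
  (forall i, (i < n.+1)%N -> `|H`_i| <= K * rho ^+ i) ->
  eq_upto n.+1 D ((\sum_j c j *: 'X^(j.+1)) * series_trunc n.+1 e * H) ->
  `|\sum_(t < n) e t.+1 * D`_t.+1| <= s * K * cross_sum s2 rho p e n.
Proof.
move=> e0 K0 rho0 cs hH hD.
have -> : \sum_(t < n) e t.+1 * D`_t.+1 =
    \sum_(js : 'I_p * 'I_n.+1) c js.1 * H`_js.2 * cov_sum s2 e 0 (js.1.+1 + js.2) n.
  pose H' := \poly_(i < n.+1) H`_i.
  have HH' : eq_upto n.+1 H H' by move=> t tn; rewrite coef_poly tn.
  under [RHS]eq_bigr do rewrite /cov_sum mulr_sumr.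
  rewrite exchange_big/=; apply: eq_bigr => t _.
  rewrite hD ?ltnS// (eq_uptoM (@eq_upto_refl _ n.+1 _) HH') ?ltnS//.
  rewrite -mulrA mulr_suml coef_sum mulr_sumr.
  rewrite -(pair_bigA _ (fun (j : 'I_p) (i : 'I_n.+1) =>
    c j * H`_i * centred_prod s2 e 0 (j.+1 + i) t))/=.
  apply: eq_bigr => j _.
  have -> : c j *: 'X^(j.+1) * (series_trunc n.+1 e * H') =
      \sum_(i < n.+1) (c j * H`_i) *: ('X^(j.+1 + i) * series_trunc n.+1 e).
    rewrite /H' poly_def !mulr_sumr; apply: eq_bigr => i _.
    by rewrite -!mul_polyC rmorphM exprD; ring.
  rewrite coef_sum mulr_sumr; apply: eq_bigr => i _.
  rewrite coefZ coef_series_shift// ?ltnS// /centred_prod/= subn0; ring.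
apply: le_trans (ler_norm_sum _ _ _) _; rewrite mulr_sumr.
apply: ler_sum => -[j i] _ /=; rewrite !normrM mulrA ler_wpM2r// -mulrA.
by apply: ler_pM => //; exact: hH.
Qed.

End covariance_sums.

Section estimation_error.
Variables (R : realType) (p1 p2 : nat).
Implicit Types eta : 'rV[R]_(p1 + p2).

(** The constant of [filter_sqr_sum_le] for the filter [arma_denom eta0 eta] is
    bounded on bounded sets of parameters. *)
Lemma arma_denom_l1_bound eta0 eta (K : R) : (forall i, `|eta 0 i| <= K) ->
  \sum_(i < size (arma_denom eta0 eta)) `|(arma_denom eta0 eta)`_i| <=
  wnorm 1 (size (ar_poly eta0)) (ar_poly eta0) * (1 + p2%:R * K).
Proof.
move=> hK.
have w1 n (p : {poly R}) : wnorm 1 n p = \sum_(i < n) `|p`_i|.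
  by apply: eq_bigr => i _; rewrite expr1n mulr1.
rewrite -w1; apply: le_trans (wnormM_le _ _ _ ler01) _.
apply: ler_wpM2l; first by apply: wnorm_ge0.
set n := size _.
have wX j : wnorm 1 n ('X^j : {poly R}) <= 1.
  rewrite -[X in wnorm _ _ X]mulr1; apply: le_trans (wnormXnM_le _ _ _ ler01) _.
  rewrite expr1n mul1r w1; case: n => [|n]; first by rewrite big_ord0.
  by rewrite big_ord_recl big1 ?addr0 ?coef1 ?normr1// => i _; rewrite coef1 normr0.
rewrite /ma_poly -scaleN1r; apply: le_trans (wnormD_le _ _ _ ler01) _.
apply: lerD; first by have := wX 0%N; rewrite expr0.
rewrite wnorm_scale normrN1 mul1r; apply: le_trans (wnorm_sum_le _ _ _ ler01) _.
apply: (@le_trans _ _ (\sum_(j < p2) K)); last first.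
  by rewrite sumr_const card_ord mulr_natl.
apply: ler_sum => j _; rewrite wnorm_scale -[leRHS]mulr1.
by apply: ler_pM; [exact: normr_ge0|exact: wnorm_ge0|exact: hK|exact: wX].
Qed.

Lemma ls_objectiveE y n eta :
  ls_objective y n eta = \sum_(t < n) resid eta y t.+1 ^+ 2.
Proof.
rewrite /ls_objective big_add1 big_mkord; apply: eq_bigr => t _.
by rewrite residE.
Qed.

(** Outside of the event on which the Gram matrix of the noise deviates from its
    mean by the order [n], the estimation error is bounded by the sample
    covariances of the noise with its past; it is bounded in all cases. *)
Lemma estimation_error_bound (A : set 'rV[R]_(p1 + p2)) eta0 (s2 : R) :
  compact A -> (forall eta, A eta -> arma_admissible eta) -> A eta0 -> 0 < s2 ->
  exists rho : R, exists2 C : R, 0 <= rho < 1 & 0 <= C /\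
  forall n y e eta, (0 < n)%N -> (2 * (p1 + p2) <= n)%N -> y 0%N = 0 -> e 0%N = 0 ->
    (forall t, (0 < t)%N -> y t = arma_rhs eta0 y e t + e t) ->
    A eta -> ls_objective y n eta <= ls_objective y n eta0 ->
    enorm (eta - eta0) <= C /\
    (gram_dev s2 (p1 + p2) e n <= s2 * n%:R / 4 ->
     enorm (eta - eta0) <= C * (cross_sum s2 rho (p1 + p2) e n / n%:R)).
Proof.
move=> cA adm A0 s20; set p := (p1 + p2)%N.
have [r [K r1 [K0 decay]]] := arma_denom_inverse_decay cA (adm _ A0) adm.
have [Kb Kb0 hKb] := compact_entries_bounded cA.
have [Kc Kc0 hKc] := arma_numer_lower_bound (adm _ A0).
have r0 : 0 < r by rewrite (lt_trans _ r1).
pose W := wnorm 1 (size (ar_poly eta0)) (ar_poly eta0) * (1 + p2%:R * Kb).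
have W0 : 0 <= W.
  by rewrite mulr_ge0 ?wnorm_ge0// addr_ge0// mulr_ge0.
(* [C1] bounds the diameter of [A]; [C2] is the constant of the sharp bound *)
pose C1 := p%:R * (Kb + Kb).
pose C2 := p%:R * (Kc * (p%:R * (8 * W ^+ 2 * K / s2))).
have C10 : 0 <= C1 by rewrite mulr_ge0// addr_ge0.
have B0 : 0 <= 8 * W ^+ 2 * K / s2.
  apply: divr_ge0; last exact: ltW.
  by apply: mulr_ge0 => //; apply: mulr_ge0 => //; exact: sqr_ge0.
have C20 : 0 <= C2 by do 3![apply: mulr_ge0 => //].
exists r^-1, (C1 + C2).
  by rewrite invr_ge0 ltW//= invf_lt1.
split; first exact: addr_ge0.
move=> n y e eta n0 pn y0 e0 ye Aeta hls.
have N0 : 0 < n%:R :> R by rewrite ltr0n.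
have sum_const (f : 'I_p -> R) (b : R) : (forall i, f i <= b) -> \sum_i f i <= p%:R * b.
  move=> fb; apply: (@le_trans _ _ (\sum_(i < p) b)); first exact: ler_sum.
  by rewrite sumr_const card_ord mulr_natl.
split.
  apply: (@le_trans _ _ C1); last by rewrite lerDl.
  apply: le_trans (enorm_le_sum _) _; apply: (sum_const _ _) => i; rewrite !mxE.
  by apply: le_trans (ler_normB _ _) _; apply: lerD; exact: hKb.
set Q := cross_sum _ _ _ _ _; move=> hG.
have Q0 : 0 <= Q.
  by apply: sumr_ge0 => i _; rewrite mulr_ge0// exprn_ge0// invr_ge0 ltW.
apply: (@le_trans _ _ (C2 * (Q / n%:R))); last first.
  by rewrite ler_wpM2r ?lerDr// divr_ge0// ltW.
pose c : 'rV[R]_p := \row_j (arma_numer eta0 eta)`_j.+1.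
pose s := enorm c.
have cs (j : 'I_p) : `|(arma_numer eta0 eta)`_j.+1| <= s.
  by have := le_enorm c j; rewrite mxE.
have s0 : 0 <= s by exact: enorm_ge0.
pose D := series_trunc n.+1 (fun t => resid eta y t - e t).
pose E := series_trunc n.+1 e.
have FD : eq_upto n.+1 (arma_denom eta0 eta * D) (arma_numer eta0 eta * E).
  exact: denom_resid_diff.
have De t : (t < n)%N -> D`_t.+1 = resid eta y t.+1 - e t.+1.
  by move=> tn; rewrite coef_poly ltnS tn.
have [H HF] : exists H, eq_upto n.+1 (arma_denom eta0 eta * H) 1.
  by apply: truncated_inverse; rewrite arma_denom0 oner_neq0.
have DH : eq_upto n.+1 D (arma_numer eta0 eta * E * H).
  have h1 := eq_uptoM FD (@eq_upto_refl _ n.+1 H).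
  have h2 := eq_uptoM (@eq_upto_refl _ n.+1 D) HF.
  rewrite mulr1 in h2; move=> t tn; rewrite -h1// -h2//.
  by rewrite (_ : D * _ = arma_denom eta0 eta * D * H)//; ring.
have cross : `|\sum_(t < n) e t.+1 * D`_t.+1| <= s * K * Q.
  apply: (@cross_upper_bound _ s2 e p n (fun j => (arma_numer eta0 eta)`_j.+1)
    H D K s r^-1) => //.
  - by rewrite invr_ge0 ltW.
  - by apply: (decay eta Aeta n.+1 H) => t tn; rewrite HF// coef1.
  - by rewrite (_ : \sum_(j < p) _ = arma_numer eta0 eta)//; exact/esym/arma_numerE.
(* the basic inequality of least squares *)
have ls : \sum_(t < n) D`_t.+1 ^+ 2 <= 2 * (s * K * Q).
  have re : resid eta0 y = e by apply/funext; exact: resid_true.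
  move: hls; rewrite !ls_objectiveE re.
  have -> : \sum_(t < n) resid eta y t.+1 ^+ 2 = \sum_(t < n) e t.+1 ^+ 2 +
      2 * \sum_(t < n) e t.+1 * D`_t.+1 + \sum_(t < n) D`_t.+1 ^+ 2.
    rewrite mulr_sumr -!big_split/=; apply: eq_bigr => t _; rewrite De//; ring.
  move: cross; rewrite ler_norml => /andP[h _]; lra.
have lower : (s2 * n%:R / 4) * s ^+ 2 <= W ^+ 2 * \sum_(t < n) D`_t.+1 ^+ 2.
  have -> : s ^+ 2 = \sum_(j < p) (arma_numer eta0 eta)`_j.+1 ^+ 2.
    by rewrite /s sqr_enorm; apply: eq_bigr => j _; rewrite mxE.
  apply: (@le_trans _ _ (\sum_(t < n) (arma_numer eta0 eta * E)`_t.+1 ^+ 2)).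
    have := @gram_lower_bound _ s2 e p n (fun j => (arma_numer eta0 eta)`_j.+1) e0
      (ltW s20) pn.
    set S := \sum_(j < p) _; set L := \sum_(t < n) _.
    have -> : \sum_(t < n) (arma_numer eta0 eta * E)`_t.+1 ^+ 2 = L.
      apply: eq_bigr => t _; rewrite arma_numerE mulr_suml coef_sum; congr (_ ^+ 2).
      apply: eq_bigr => j _; rewrite -scalerAl coefZ coef_series_shift// ?ltnS//.
      by rewrite -arma_numerE.
    apply: le_trans; apply: ler_wpM2r; last by lra.
    by apply: sumr_ge0 => j _; exact: sqr_ge0.
  have E00 : (arma_numer eta0 eta * E)`_0 = 0 by rewrite coef0M arma_numer0 mul0r.
  have D00 : D`_0 = 0 by rewrite coef_poly/= resid0 e0 subrr.
  have := filter_sqr_sum_le n.+1 (arma_denom eta0 eta) D.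
  rewrite [X in X <= _](_ : _ = \sum_(t < n.+1) (arma_numer eta0 eta * E)`_t ^+ 2); last first.
    by apply: eq_bigr => t _; rewrite FD.
  rewrite !big_ord_recl E00 D00 expr0n/= !add0r => h; apply: le_trans h _.
  apply: ler_wpM2r; first by apply: sumr_ge0 => t _; exact: sqr_ge0.
  apply: lerXn2r; rewrite ?nnegrE ?sumr_ge0//.
  by apply: arma_denom_l1_bound => i; exact: hKb.
have sbound : s <= 8 * W ^+ 2 * K / s2 * (Q / n%:R).
  have h := le_trans lower (ler_wpM2l (sqr_ge0 W) ls).
  have [->|sn] := eqVneq s 0.
    by apply: mulr_ge0 => //; exact: divr_ge0 Q0 (ltW N0).
  have sp : 0 < s by rewrite lt_def sn.
  rewrite -(ler_pM2r sp) -(ler_pM2l (_ : 0 < s2 * n%:R / 4)); last first.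
    by rewrite divr_gt0// mulr_gt0.
  rewrite -expr2; apply: le_trans h _; rewrite le_eqVlt; apply/orP; left; apply/eqP.
  by field; rewrite (gt_eqF N0) (gt_eqF s20).
apply: le_trans (enorm_le_sum _) _; rewrite /C2 -!mulrA; apply: (sum_const _ _) => i.
apply: le_trans (hKc eta i) _; apply: ler_wpM2l => //.
apply: (sum_const _ _) => j; apply: le_trans (cs j) _.
by move: sbound; rewrite -!mulrA.
Qed.

End estimation_error.

(** * Moments of the estimation error *)

Section power_comparison.
Variable R : realType.

Lemma powR_le_exprn (x q : R) (n : nat) : 0 <= x -> q <= n%:R -> 0 <= q ->
  x `^ q <= 1 + x ^+ n.
Proof.
move=> x0 qn q0; have [x1|/ltW x1] := leP x 1.
  apply: (@le_trans _ _ 1); last by rewrite lerDl exprn_ge0.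
  rewrite [leRHS](_ : 1 = 1 `^ q); last by rewrite powR1.
  by rewrite ge0_ler_powR ?nnegrE.
rewrite -powR_mulrn//; apply: le_trans (ler_powR x1 qn) _.
by rewrite lerDr.
Qed.

Lemma exprn_le_powR (x a : R) (n : nat) : 0 <= x -> n%:R <= a ->
  x ^+ n <= 1 + x `^ a.
Proof.
move=> x0 na; have [x1|/ltW x1] := leP x 1.
  by apply: (@le_trans _ _ 1); rewrite ?exprn_ile1// lerDl powR_ge0.
rewrite -powR_mulrn//; apply: le_trans (ler_powR x1 na) _.
by rewrite lerDr.
Qed.

(** The order [2 k + 2] of the moments used for the sample covariances; it
    requires moments of the noise of order [4 k + 4 <= 4 q]. *)
Lemma moment_order_exists (q : R) : 1 <= q ->
  exists k : nat, q <= (2 * k.+1)%:R /\ k.+1%:R <= q.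
Proof.
move=> q1; pose k := Num.trunc (q / 2).
have /andP[k1 k2] : k%:R <= q / 2 < k.+1%:R by apply: truncn_itv; lra.
exists k; split; first by rewrite natrM; lra.
have [q2|q2] := leP 2 q; first by rewrite -natr1; lra.
suff -> : k = 0%N by [].
by apply/eqP; rewrite -leqn0 -ltnS truncn_lt_nat; lra.
Qed.

Lemma geometric_sum_le (rho : R) n : 0 <= rho < 1 ->
  \sum_(s < n) rho ^+ s <= (1 - rho)^-1.
Proof.
move=> /andP[r0 r1]; have d0 : 0 < 1 - rho by rewrite subr_gt0.
rewrite -[leRHS]mul1r ler_pdivlMr//.
have -> : (\sum_(s < n) rho ^+ s) * (1 - rho) = 1 - rho ^+ n.
  by rewrite -[RHS]opprB subrX1; ring.
by rewrite lerBlDr lerDl exprn_ge0.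
Qed.

End power_comparison.

Section weighted_sum_moments.
Context d (T : measurableType d) (R : realType) (P : probability T R).

Lemma weighted_sum_moment (I : finType) (w : I -> R) (f : I -> T -> R) (k : nat)
    (W b : R) : 0 <= b ->
  (forall i, 0 <= w i) -> \sum_i w i <= W ->
  (forall i, measurable_fun setT (f i)) ->
  (forall i, P.-integrable setT (EFin \o (fun w => f i w ^+ (2 * k.+1))) /\
     \int[P]_w (f i w ^+ (2 * k.+1)) <= b) ->
  P.-integrable setT (EFin \o (fun z => (\sum_i w i * `|f i z|) ^+ (2 * k.+1))) /\
  \int[P]_z ((\sum_i w i * `|f i z|) ^+ (2 * k.+1)) <= W ^+ (2 * k.+1) * b.
Proof.
move=> b0 w0 wW mf hf.
have hsum (r : seq I) :
    P.-integrable setT (EFin \o (fun z => \sum_(i <- r) w i * f i z ^+ (2 * k.+1))) /\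
    \int[P]_z (\sum_(i <- r) w i * f i z ^+ (2 * k.+1)) <= (\sum_(i <- r) w i) * b.
  elim: r => [|i r [IH1 IH2]].
    rewrite big_nil mul0r; under eq_fun do rewrite big_nil.
    by split; [exact: integrable_cst_fin|rewrite Rintegral_cst_prob].
  have E : (fun z => \sum_(j <- i :: r) w j * f j z ^+ (2 * k.+1)) =
      fun z => w i * f i z ^+ (2 * k.+1) + 1 * \sum_(j <- r) w j * f j z ^+ (2 * k.+1).
    by apply/funext => z; rewrite big_cons mul1r.
  rewrite E; have [h1 h2] := hf i; split; first exact: integrable_linear.
  rewrite Rintegral_linear// big_cons mulrDl mul1r; apply: lerD => //.
  by rewrite ler_wpM2l.
have [s1 s2] := hsum (index_enum I).
have W0 : 0 <= W by apply: le_trans wW; exact: sumr_ge0.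
have K1 : (2 * k.+1 = (2 * k).+1.+1)%N by rewrite mulnS.
have s0 z : 0 <= \sum_i w i * f i z ^+ (2 * k.+1).
  by apply: sumr_ge0 => i _; rewrite mulr_ge0// expr_even_ge0.
have dom z : (\sum_i w i * `|f i z|) ^+ (2 * k.+1) <=
    W ^+ (2 * k).+1 * (\sum_i w i * f i z ^+ (2 * k.+1)) + 0 * 0.
  rewrite mulr0 addr0 [X in _ ^+ X <= _]K1.
  apply: le_trans (weighted_power_mean _ w0 (fun i => normr_ge0 (f i z))) _.
  rewrite -K1; under [X in _ * X <= _]eq_bigr do rewrite expr_even_norm.
  by apply: ler_wpM2r => //; apply: lerXn2r; rewrite ?nnegrE ?sumr_ge0.
have idom := integrable_linear (W ^+ (2 * k).+1) 0 s1 (integrable_cst_fin P 0).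
have iS : P.-integrable setT (EFin \o (fun z => (\sum_i w i * `|f i z|) ^+ (2 * k.+1))).
  apply: integrable_dominated idom.
    apply: measurable_funX; apply: measurable_sum => i; apply: measurable_funM => //.
    by apply: measurableT_comp.
  by move=> z; rewrite ger0_norm ?expr_even_ge0.
split => //; apply: le_trans (le_Rintegral _ iS idom (fun z _ => dom z)) _ => //.
rewrite Rintegral_linear//; last exact: integrable_cst_fin.
rewrite mul0r addr0.
have -> : W ^+ (2 * k.+1) * b = W ^+ (2 * k).+1 * (W * b) by rewrite K1 exprSr mulrA.
apply: ler_wpM2l; first exact: exprn_ge0.
by apply: le_trans s2 _; exact: ler_wpM2r.
Qed.

Lemma integral_EFin_le (f g : T -> R) (c : R) : measurable_fun setT f ->
  (forall w, 0 <= f w <= g w) -> P.-integrable setT (EFin \o g) ->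
  \int[P]_w (g w) <= c -> (\int[P]_w (f w)%:E <= c%:E)%E.
Proof.
move=> mf fg ig gc.
apply: (@le_trans _ _ (\int[P]_w (g w)%:E)%E).
  apply: ge0_le_integral => //.
  - by move=> w _; rewrite lee_fin; case/andP: (fg w).
  - exact/measurable_EFinP.
  - exact: measurable_int ig.
  - by move=> w _; rewrite lee_fin; case/andP: (fg w).
rewrite -[leLHS]fineK ?lee_fin//; exact: integrable_fin_num ig.
Qed.

Lemma measurable_enorm m (v : T -> 'rV[R]_m) :
  (forall i, measurable_fun setT (fun w => v w 0 i)) ->
  measurable_fun setT (fun w => enorm (v w)).
Proof.
move=> mv; apply: (@measurableT_comp _ _ _ _ _ _ (@Num.sqrt R)).
  by apply: continuous_measurable_fun; exact: sqrt_continuous.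
by apply: measurable_sum => i; exact: measurable_funX.
Qed.

End weighted_sum_moments.

(** On the event where the Gram matrix is well conditioned, the error is of the
    order of the normalized cross sum; on its complement the trivial bound by the
    diameter of the parameter set is multiplied by a power of [4 G / (s2 n)],
    which exceeds [1] there. *)
Lemma scaled_error_power_le (R : realType) (n k : nat) (q s2 C err Q G : R) :
  (0 < n)%N -> 0 <= q -> q <= (2 * k.+1)%:R -> 0 < s2 -> 0 <= C ->
  0 <= err -> 0 <= Q -> 0 <= G -> err <= C ->
  (G <= s2 * n%:R / 4 -> err <= C * (Q / n%:R)) ->
  (Num.sqrt n%:R * err) `^ q <=
    1 + (C ^+ (2 * k.+1) / n%:R ^+ k.+1 * Q ^+ (2 * k.+1) +
         C ^+ (2 * k.+1) * (4 / s2) ^+ (2 * k.+1) / n%:R ^+ k.+1 * G ^+ (2 * k.+1)).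
Proof.
move=> n0 q0 qk s20 C0 err0 Q0 G0 errC hG.
have N0 : 0 < n%:R :> R by rewrite ltr0n.
apply: le_trans (powR_le_exprn _ qk q0) _; first by rewrite mulr_ge0// sqrtr_ge0.
rewrite lerD2l exprMn exprM sqr_sqrtr ?(ltW N0)//.
have Nk (x : R) : n%:R ^+ k.+1 * (x / n%:R) ^+ (2 * k.+1) = x ^+ (2 * k.+1) / n%:R ^+ k.+1.
  rewrite expr_div_n mulrCA; congr (_ * _).
  rewrite (_ : (2 * k.+1)%N = (k.+1 + k.+1)%N); last by rewrite mul2n addnn.
  by rewrite exprD invfM mulrA divff ?mul1r// expf_neq0// gt_eqF.
have [Gs|/ltW Gs] := leP G (s2 * n%:R / 4).
  apply: (@le_trans _ _ (n%:R ^+ k.+1 * (C * Q / n%:R) ^+ (2 * k.+1))).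
    apply: ler_wpM2l; first by rewrite exprn_ge0// ltW.
    have e1 := hG Gs; rewrite mulrA in e1.
    by apply: lerXn2r => //; rewrite nnegrE ?(le_trans err0 e1).
  rewrite Nk exprMn mulrAC lerDl.
  by apply: mulr_ge0; [apply: divr_ge0|exact: expr_even_ge0];
    rewrite ?mulr_ge0 ?expr_even_ge0// exprn_ge0// ltW.
apply: (@le_trans _ _ (n%:R ^+ k.+1 * (C * (4 / s2) * G / n%:R) ^+ (2 * k.+1))).
  apply: ler_wpM2l; first by rewrite exprn_ge0// ltW.
  have e1 : C <= C * (4 / s2) * G / n%:R.
    rewrite -!mulrA ler_peMr// -(ler_pM2l (_ : 0 < s2 * n%:R / 4)); last first.
      by rewrite divr_gt0// mulr_gt0.
    rewrite mulr1; apply: le_trans Gs _; rewrite le_eqVlt; apply/orP; left; apply/eqP.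
    by field; rewrite (gt_eqF N0) (gt_eqF s20).
  by apply: lerXn2r; rewrite ?nnegrE ?(le_trans errC e1)// (le_trans C0 e1).
rewrite Nk !exprMn [X in X <= _]mulrAC lerDr.
by apply: mulr_ge0; [apply: divr_ge0|exact: expr_even_ge0];
  rewrite ?expr_even_ge0// exprn_ge0// ltW.
Qed.

Lemma centred_prod_sym (R : realType) (s2 : R) (e : nat -> R) i j t :
  centred_prod s2 e i j t = centred_prod s2 e j i t.
Proof.
by rewrite /centred_prod eq_sym; case: eqP => [->//|_]; rewrite mulrC.
Qed.

Lemma cov_sum_sym (R : realType) (s2 : R) (e : nat -> R) i j n :
  cov_sum s2 e i j n = cov_sum s2 e j i n.
Proof. by apply: eq_bigr => t _; exact: centred_prod_sym. Qed.

Lemma moments_from_sup d (T : measurableType d) (R : realType) (P : probability T R)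
    (eps : nat -> {RV P >-> R}) (a : R) (n : nat) : n%:R <= a ->
  (ereal_sup [set 'E_P[(fun w => `|eps t w| `^ a)%R]
     | t in [set t | (1 <= t)%N]] < +oo)%E ->
  exists B : R, forall t, (1 <= t)%N ->
   P.-integrable setT (EFin \o (fun w => `|eps t w| ^+ n)) /\
   \int[P]_w (`|eps t w| ^+ n) <= B.
Proof.
move=> na; set S := ereal_sup _ => Soo.
have ES t : (1 <= t)%N -> (\int[P]_w (`|eps t w| `^ a)%:E <= S)%E.
  by move=> t1; apply: ereal_sup_ubound; exists t => //; rewrite unlock.
have S0 : (0 <= S)%E.
  by apply: le_trans (ES 1%N isT); apply: integral_ge0 => w _; rewrite lee_fin powR_ge0.
have Sfin : S \is a fin_num by rewrite ge0_fin_numE.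
exists (1 * 1 + 1 * fine S) => t t1.
have mabs : measurable_fun setT (fun w => `|eps t w|).
  by apply: measurableT_comp => //; exact: measurable_funPT.
have ia : P.-integrable setT (EFin \o (fun w => `|eps t w| `^ a)).
  apply/integrableP; split.
    apply/measurable_EFinP.
    exact: (measurableT_comp (measurable_powR a) mabs).
  apply: le_lt_trans Soo; apply: le_trans (ES t t1).
  rewrite le_eqVlt; apply/orP; left; apply/eqP.
  by apply: eq_integral => w _ /=; rewrite ger0_norm ?powR_ge0.
have idom := integrable_linear 1 1 (integrable_cst_fin P 1) ia.
have le w : `|eps t w| ^+ n <= 1 * 1 + 1 * `|eps t w| `^ a.
  by rewrite !mul1r exprn_le_powR.
have ie : P.-integrable setT (EFin \o (fun w => `|eps t w| ^+ n)).
  apply: integrable_dominated idom; first exact: measurable_funX.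
  by move=> w; rewrite ger0_norm ?exprn_ge0.
split => //; apply: le_trans (le_Rintegral _ ie idom (fun w _ => le w)) _ => //.
rewrite Rintegral_linear//; last exact: integrable_cst_fin.
rewrite Rintegral_cst_prob lerD2l !mul1r; apply: fine_le => //.
  exact: integrable_fin_num ia.
exact: ES.
Qed.

Theorem theorem3p3
  (R : realType) (d : measure_display) (T : measurableType d)
  (P : probability T R)
  (p1 p2 : nat) (hp : (1 <= p1 + p2)%N)
  (Pi : set 'rV[R]_(p1 + p2)) (hPi : compact Pi)
  (hadm : forall eta, Pi eta -> arma_admissible eta)
  (eta0 : 'rV[R]_(p1 + p2)) (heta0 : interior Pi eta0)
  (eps : nat -> {RV P >-> R}) (y : nat -> T -> R)
  (heps0 : forall w, eps 0%N w = 0)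
  (hy0 : forall w, y 0%N w = 0)
  (hy : forall t w, (1 <= t)%N ->
     y t w = arma_rhs eta0 (y ^~ w) (eps ^~ w) t + eps t w)
  (hindep : independent_RVs [set t | (1 <= t)%N] eps)
  (hmean : forall t, (1 <= t)%N -> ('E_P[eps t] = 0)%E)
  (sigma : R)
  (hvar : forall t, (1 <= t)%N ->
     ('E_P[(fun w => eps t w ^+ 2)%R] = (sigma ^+ 2)%:E)%E)
  (alpha1 xi M1 : R) (halpha1 : 0 < alpha1) (hxi : 0 < xi) (hM1 : 0 < M1)
  (hcdf : forall s1 s2 : R, 0 < s2 - s1 -> s2 - s1 <= xi ->
     (ereal_sup [set x : \bar R | exists (t m : nat) (v : 'rV[R]_m),
         [/\ (1 <= m <= t)%N, enorm v = 1%R &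
            x = `| cdf (noise_comb eps t v) s2 - cdf (noise_comb eps t v) s1 |]]
      <= (M1 * (s2 - s1) `^ alpha1)%:E)%E)
  (q q1 : R) (hq : 1 <= q) (hq1 : q < q1)
  (hmom : (ereal_sup [set 'E_P[(fun w => `|eps t w| `^ (4 * q1))%R]
                     | t in [set t | (1 <= t)%N]] < +oo)%E)
  (etahat : nat -> T -> 'rV[R]_(p1 + p2))
  (hmeas : forall n, (1 <= n)%N ->
     forall i, measurable_fun setT (fun w => etahat n w 0 i))
  (hargmin : forall n w, (1 <= n)%N ->
     is_argmin Pi (ls_objective (y ^~ w) n) (etahat n w)) :
  exists C : R, \forall n \near \oo,
    ('E_P[(fun w => enorm (Num.sqrt n%:R *: (etahat n w - eta0)) `^ q)%R]
       <= C%:E)%E.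
Proof.
have Pi0 : Pi eta0 by exact: interior_subset.
pose s2 := sigma ^+ 2.
have var t : (1 <= t)%N -> (\int[P]_w (eps t w ^+ 2)%:E = s2%:E)%E.
  by move=> t1; have := hvar t t1; rewrite unlock.
have mean t : (1 <= t)%N -> (\int[P]_w (eps t w)%:E = 0)%E.
  by move=> t1; have := hmean t t1; rewrite unlock.
have s2_gt0 : 0 < s2.
  (* the noise at time 1, as a linear combination of length 1 *)
  pose v : 'rV[R]_1 := const_mx 1.
  have v1 : enorm v = 1 by rewrite /enorm big_ord1 mxE expr1n sqrtr1.
  apply: (@second_moment_gt0 _ _ _ _ (noise_comb eps 1 v) alpha1 xi M1) => //.
  - exact: sqr_ge0.
  - move=> s t st0 st; apply: le_trans (hcdf s t st0 st).
    by apply: ereal_sup_ubound; exists 1%N, 1%N, v.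
  - rewrite -(var 1%N)//; apply: eq_integral => w _.
    by rewrite /noise_comb big_ord1 /= mxE mulr1.
have [k [qk kq]] := moment_order_exists hq.
have q0 : 0 <= q by rewrite (le_trans _ hq).
have mom_order : (2 * (2 * k.+1))%:R <= 4 * q1 by rewrite !natrM; lra.
have [B hB] := moments_from_sup mom_order hmom.
have mom t : (1 <= t)%N ->
    P.-integrable setT (EFin \o (fun w => eps t w ^+ (2 * (2 * k.+1)))) /\
    \int[P]_w (eps t w ^+ (2 * (2 * k.+1))) <= B.
  have E : (fun w => eps t w ^+ (2 * (2 * k.+1))) = fun w => `|eps t w| ^+ (2 * (2 * k.+1)).
    by apply/funext => w; rewrite expr_even_norm.
  by rewrite E; exact: hB.
have [C0 C00 hC0] := centred_cov_moment heps0 hindep mean var mom.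
have cov_mom i j n :
    P.-integrable setT (EFin \o (fun w => cov_sum s2 (eps ^~ w) i j n ^+ (2 * k.+1))) /\
    \int[P]_w (cov_sum s2 (eps ^~ w) i j n ^+ (2 * k.+1)) <= C0 * n%:R ^+ k.+1.
  have [ij|/ltnW ji] := leqP i j; first exact: hC0.
  have E : (fun w => cov_sum s2 (eps ^~ w) i j n ^+ (2 * k.+1)) =
           (fun w => cov_sum s2 (eps ^~ w) j i n ^+ (2 * k.+1)).
    by apply/funext => w; rewrite cov_sum_sym.
  by rewrite E; exact: hC0.
have meas_cov i j n : measurable_fun setT (fun w => cov_sum s2 (eps ^~ w) i j n).
  apply: measurable_sum => t; rewrite /centred_prod; case: (i == j).
    by case: (i <= t)%N => //; apply: measurable_funD => //; exact: measurable_funX.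
  exact: measurable_funM.
have [rho [C rho01 [C_ge0 herr]]] := estimation_error_bound hPi hadm Pi0 s2_gt0.
have rho0 : 0 <= rho by case/andP: rho01.
pose p := (p1 + p2)%N; pose K := (2 * k.+1)%N.
pose W := p%:R * (1 - rho)^-1.
pose W' : R := \sum_(ij : 'I_p * 'I_p) 1.
exists (1 + (C ^+ K * (W ^+ K * C0) + C ^+ K * (4 / s2) ^+ K * (W' ^+ K * C0))).
exists (2 * p).+1 => // n /= pn.
have n0 : (0 < n)%N by exact: leq_ltn_trans pn.
have N0 : 0 < n%:R ^+ k.+1 :> R by rewrite exprn_gt0// ltr0n.
pose b := C0 * n%:R ^+ k.+1.
have b0 : 0 <= b by rewrite mulr_ge0// ltW.
have [iQ hQ] : P.-integrable setT
    (EFin \o (fun w => cross_sum s2 rho p (eps ^~ w) n ^+ K)) /\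
    \int[P]_w (cross_sum s2 rho p (eps ^~ w) n ^+ K) <= W ^+ K * b.
  apply: weighted_sum_moment => //.
  - by move=> [j i]; exact: exprn_ge0.
  - rewrite -(pair_bigA _ (fun (_ : 'I_p) (i : 'I_n.+1) => rho ^+ i))/=.
    rewrite /W mulr_natl -[X in (_ *+ X)](card_ord p) -sumr_const.
    by apply: ler_sum => j _; exact: geometric_sum_le.
have [iG hG] : P.-integrable setT
    (EFin \o (fun w => gram_dev s2 p (eps ^~ w) n ^+ K)) /\
    \int[P]_w (gram_dev s2 p (eps ^~ w) n ^+ K) <= W' ^+ K * b.
  have E : (fun w => gram_dev s2 p (eps ^~ w) n ^+ K) = fun w =>
      (\sum_(ij : 'I_p * 'I_p) 1 * `|cov_sum s2 (eps ^~ w) ij.1.+1 ij.2.+1 n|) ^+ K.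
    by apply/funext => w; congr (_ ^+ _); apply: eq_bigr => ij _; rewrite mul1r.
  by rewrite E; apply: weighted_sum_moment.
have mZ : measurable_fun setT
    (fun w => enorm (Num.sqrt n%:R *: (etahat n w - eta0)) `^ q).
  apply: (measurableT_comp (measurable_powR q)); apply: measurable_enorm => i.
  have -> : (fun w => (Num.sqrt n%:R *: (etahat n w - eta0)) 0 i) =
      fun w => Num.sqrt n%:R * (etahat n w 0 i - eta0 0 i).
    by apply/funext => w; rewrite !mxE.
  apply: measurable_funM => //; apply: measurable_funB => //; exact: hmeas.
pose cQ := C ^+ K / n%:R ^+ k.+1; pose cG := C ^+ K * (4 / s2) ^+ K / n%:R ^+ k.+1.
have CK0 : 0 <= C ^+ K by exact: exprn_ge0.
have cQ0 : 0 <= cQ by rewrite divr_ge0// ltW.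
have cG0 : 0 <= cG.
  by rewrite divr_ge0 ?(ltW N0)// mulr_ge0// exprn_ge0// divr_ge0// ltW.
have idom := integrable_linear 1 1 (integrable_cst_fin P 1) (integrable_linear cQ cG iQ iG).
rewrite unlock; apply: (integral_EFin_le mZ _ idom).
  move=> w; rewrite powR_ge0/= enormZ ger0_norm ?sqrtr_ge0// !mul1r.
  have [Peta hmin] := hargmin n w n0.
  have [e1 e2] := herr n (y ^~ w) (eps ^~ w) (etahat n w) n0 (ltnW pn)
    (hy0 w) (heps0 w) (fun t t0 => hy t w t0) Peta (hmin _ Pi0).
  apply: scaled_error_power_le => //; first exact: enorm_ge0.
  - by apply: sumr_ge0 => js _; rewrite mulr_ge0// exprn_ge0.
  - by apply: sumr_ge0.
rewrite Rintegral_linear//; last 2 first.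
- exact: integrable_cst_fin.
- exact: integrable_linear.
rewrite Rintegral_linear// Rintegral_cst_prob !mul1r lerD2l; apply: lerD.
  apply: le_trans (ler_wpM2l cQ0 hQ) _; rewrite /cQ /b le_eqVlt; apply/orP; left.
  by apply/eqP; field; rewrite gt_eqF// ltr0n.
apply: le_trans (ler_wpM2l cG0 hG) _; rewrite /cG /b le_eqVlt; apply/orP; left.
by apply/eqP; field; rewrite !gt_eqF// ltr0n.
Qed.
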